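(* For every real sequence $x=\{x_1,x_2,\ldots\}\in\mathbb R^\infty$ we have $$US_x^r=S_x^r\subseteq Q_x=Q_{\hat x}=US_{\hat x}^r .$$
   Context: $\mathbb R^\infty$ is the space of all real sequences and $\hat{\mathbb R}=[-\infty,+\infty]$. An infinite real matrix $w=\{w_{ij}\}_{i,j\ge1}$ acts on $x\in\mathbb R^\infty$ by $(wx)_i=\sum_jw_{ij}x_j$, with domain $\mathcal D(w)=\{x\in\mathbb R^\infty:\sum_j|w_{ij}x_j|<\infty\ \forall i\}$. $\mathcal S^r$ is the set of matrices with non-negative entries all of whose row sums are equal to $1$ and all of whose column sums are at most $1$. $\mathcal{US}^r$ is the set of matrices $w\in\mathcal S^r$ such that $w_{ij}=|(u_i,e_j)_H|^2$ for some complete orthonormal set $\{e_1,e_2,\ldots\}$ in a separable complex Hilbert space $H$ and some (not necessarily complete) orthonormal set $\{u_1,u_2,\ldots\}\subset H$. $S_x^r$ (respectively $US_x^r$) is the set of all sequences $y\in\mathbb R^\infty$ such that $y=wx$ for some $w\in\mathcal S^r$ (respectively $w\in\mathcal{US}^r$) with $x\in\mathcal D(w)$. For $m=1,2,\ldots$ let $R_m^+(x)$ and $R_m^-(x)$ be respectively the supremum and the infimum (in $\hat{\mathbb R}$) of $\sum_{n=1}^mx_{j_n}$ over all collections of $m$ distinct indices $j_1,\ldots,j_m$. $Q_x$ is the set of all $y\in\mathbb R^\infty$ such that $R_m^-(x)\le\sum_{n=1}^my_{i_n}\le R_m^+(x)$ for each $m=1,2,\ldots$ and each collection of $m$ distinct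 positive integers $i_1,\ldots,i_m$. Let $x^-:=\liminf_{j\to\infty}x_j\in\hat{\mathbb R}$ and $x^+:=\limsup_{j\to\infty}x_j\in\hat{\mathbb R}$. $\hat x$ is the sequence obtained from $x$ by adding infinitely many entries $x^-$ whenever $x^-$ is finite and infinitely many entries $x^+$ whenever $x^+$ is finite. (The sets $S_x^r$, $US_x^r$, $Q_x$ do not depend on the order of entries of $x$.) *)

(* Defs.v *)
From HB Require Import structures.
From mathcomp Require Import all_boot all_order all_algebra.
From mathcomp Require Import complex.
From mathcomp Require Import all_classical all_reals all_analysis.

Set Implicit Arguments.
Unset Strict Implicit.
Unset Printing Implicit Defensive.

Import Order.TTheory GRing.Theory Num.Theory.
Import numFieldNormedType.Exports.

Local Open Scope classical_set_scope.
Local Open Scope ring_scope.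

(* Sequences and infinite matrices are indexed by nat, i.e. from 0. *)

Section Matrices.
Variable R : realType.
Implicit Types (w : nat -> nat -> R) (x y : nat -> R).

(* The paper's D(w) and wx; [mx_act w x i] is the sum of the i-th series only
   when it converges, in particular when [mx_dom w x] holds. *)
Definition mx_dom w x : Prop :=
  forall i, (\sum_(0 <= j <oo) `|w i j * x j|%:E < +oo)%E.

Definition mx_act w x : nat -> R :=
  fun i => limn (series (fun j => w i j * x j)).

Definition row_stochastic w : Prop :=
  [/\ forall i j, 0 <= w i j,
      forall i, (\sum_(0 <= j <oo) (w i j)%:E = 1)%E
    & forall j, (\sum_(0 <= i <oo) (w i j)%:E <= 1)%E].

Section Hilbert.
Variables (H : completeNormedModType R[i]) (ip : {dot H for Num.conj}).

Definition norm_of_dot : Prop := forall h : H, `|h| ^+ 2 = ip h h.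

Definition orthonormal_seq (u : nat -> H) : Prop :=
  forall i j, ip (u i) (u j) = (i == j)%:R.

(* Complete = maximal among orthonormal sets. *)
Definition complete_orthonormal_seq (e : nat -> H) : Prop :=
  orthonormal_seq e /\ forall h : H, (forall j, ip h (e j) = 0) -> h = 0.

End Hilbert.

Definition separable (T : topologicalType) : Prop :=
  exists2 D : set T, countable D & dense D.

(* A complex Hilbert space is a complete normed space over R[i] whose norm is
   induced by an inner product (linear on the left, conjugate-linear on the
   right).  The equation on moduli lives in R[i]. *)
Definition row_unistochastic w : Prop :=
  row_stochastic w /\
  exists (H : completeNormedModType R[i]) (ip : {dot H for Num.conj})
         (e u : nat -> H),
    [/\ norm_of_dot ip, separable H, complete_orthonormal_seq ip e,
        orthonormal_seq ip u
      & forall i j, (w i j)%:C%C = `|ip (u i) (e j)| ^+ 2].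

Definition S_set x : set (nat -> R) :=
  [set y | exists w, [/\ row_stochastic w, mx_dom w x & y = mx_act w x]].

Definition US_set x : set (nat -> R) :=
  [set y | exists w, [/\ row_unistochastic w, mx_dom w x & y = mx_act w x]].

End Matrices.

Section Ranges.
Variable R : realType.
Implicit Types (x y z : nat -> R) (m : nat).

Definition Rplus x m : \bar R :=
  ereal_sup [set (\sum_(n < m) x (j n))%:E | j in
               [set j : 'I_m -> nat | injective j]].

Definition Rminus x m : \bar R :=
  ereal_inf [set (\sum_(n < m) x (j n))%:E | j in
               [set j : 'I_m -> nat | injective j]].

Definition Q_set x : set (nat -> R) :=
  [set y | forall m, (0 < m)%N -> forall i : 'I_m -> nat, injective i ->
     (Rminus x m <= (\sum_(n < m) y (i n))%:E <= Rplus x m)%E].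

Definition xinf x : \bar R := limn_einf (EFin \o x).
Definition xsup x : \bar R := limn_esup (EFin \o x).

(* The entries of the extended sequence: x itself, then countably many copies
   of each of the two limit points that is finite. *)
Definition hat_index x : set (nat + nat + nat) :=
  [set t | match t with
           | inl (inl _) => true
           | inl (inr _) => xinf x \is a fin_num
           | inr _ => xsup x \is a fin_num
           end].

Definition hat_entry x (t : nat + nat + nat) : R :=
  match t with
  | inl (inl n) => x n
  | inl (inr _) => fine (xinf x)
  | inr _ => fine (xsup x)
  end.

(* [z] lists the entries of the extended sequence in some order, which is left
   unspecified: the entry indexed by t is put at position [r t]. *)
Definition is_hat x z : Prop :=
  exists2 r : nat + nat + nat -> nat,
    set_bij (hat_index x) [set: nat] r
    & forall t, hat_index x t -> z (r t) = hat_entry x t.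

Lemma is_hat_exists x : exists z, is_hat x z.
Proof.
have infx : ([set: nat] #<= hat_index x)%card.
  have inj : {in [set: nat] &, injective (fun n => inl (inl n) : nat + nat + nat)}.
    by move=> a b _ _ [].
  rewrite -(card_le_eql (inj_card_eq inj)); apply: subset_card_le.
  by move=> _ [n _ <-].
have /card_set_bijP[r rb] : (hat_index x #= [set: nat])%card.
  by rewrite card_eq_le infx andbT; exact: countableP.
pose s := pinv_ (fun=> inl (inl 0%N)) (hat_index x) r.
exists (hat_entry x \o s), r => // t xt /=.
by rewrite /s pinvKV ?inE//; exact: (set_bij_inj rb).
Qed.

End Ranges.

(* Main.v *)
Require Import Defs.
From HB Require Import structures.
From mathcomp Require Import all_boot all_order all_algebra.
From mathcomp Require Import complex ring lra zify.
From mathcomp Require Import all_classical all_reals all_analysis.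

(** That [S_set x] lies in [Q_set x] is convexity. If [y = w x] for a matrix
    with row sums one and column sums at most one, then for every level s the
    excesses of finitely many y_i over s have a sum at most the supremum of the
    finite sums of excesses of the x_j over s. These inequalities, for all s,
    for x and y and for - x and - y, define [Q_set x] ([Q_set_majorized]). Below
    the upper limit of x the excesses of the x_j have unbounded sums, and
    nothing is required there. Therefore adding copies of the two limits of x
    changes nothing, which is [Q_set x = Q_set xhat] ([limit_copies_majorized]).

    For the other inclusions one needs orthonormal vectors u_i in which the
    diagonal operator X with entries x_j has the diagonal y.  All vectors below
    have finite support ([realizable]), so that domains are no issue.  They are
    built one by one as in Horn's theorem.  Let v_0, v_1, ... be a list of
    orthonormal vectors on which X is diagonal, with values X_0, X_1, ..., and let
    the next row y lie between the neighbours X_k and X_(k+1).  A rotation in the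
    plane of v_k and v_(k+1) gives a vector of value y, which is taken out, and one
    of value X_k + X_(k+1) - y, which replaces both in the list.  If the sum of any
    m rows was at most the sum of the first m values, then this remains so for the
    remaining rows and the new list, whatever the order of the values
    ([realizable_infinite_list], [realizable_finite_list]).  Rows with infinitely
    many entries above and infinitely many below are simpler: each of them gets
    two entries of its own ([realizable_mid]).

    Let c be the upper limit of x, and suppose that it is finite.  The entries
    above c in decreasing order, continued by entries near c if they are finitely
    many, form a list for the rows above c.  The difficulty is to save infinitely
    many entries near c for the rows below c.  For the extended sequence the copies
    of c do.  For [y = w x] one looks at the rows of w that cross c, that is, use
    entries on both sides of c.  If there is one, the inequalities at levels near c
    are strict ([acts_slack]), and a sequence of entries that tends to c fast
    enough can be spared ([upper_part_exists]).  The same is done at the lower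
    limit ([realizable_edges]).  If no row crosses c, the problem splits at c into
    two problems with separate rows and columns.  The lower one has a smaller upper
    limit and may split again, even transfinitely often.  So one cuts at all
    accumulation points that no row crosses at the same time, and solves each of
    the resulting classes on its own ([acts_realizable_class]): the limits of the
    entries in a class are crossed, or have infinitely many copies, or are
    endpoints of the class, which no row reaches or at which the entries form a
    single monotone list.  A class with finitely many columns is the theorem of
    Schur and Horn ([realizable_finite]).

    Finally the vectors are placed in the Hilbert space of square-summable complex
    sequences, and the column sums are bounded by Bessel's inequality. *)

Set Implicit Arguments.
Unset Strict Implicit.
Unset Printing Implicit Defensive.

Import Order.TTheory GRing.Theory Num.Theory.
Import numFieldNormedType.Exports.

Local Open Scope classical_set_scope.
Local Open Scope ring_scope.

(** * Finitely supported vectors *)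

Section FiniteVectors.
Variable R : realType.
Implicit Types (a x y : nat -> R) (p q r : {poly R}) (I J : set nat) (v : nat -> {poly R}).

(** Finitely supported vectors are encoded as polynomials, the j-th coordinate
    being the j-th coefficient; [wform (fun=> 1)] is then the inner product and
    [wform x] the form of the diagonal operator with entries [x]. *)
Definition wform a p q : R := \sum_(j < size p) a j * (p`_j * q`_j).

Lemma wform_widen a p q N : (size p <= N)%N ->
  wform a p q = \sum_(j < N) a j * (p`_j * q`_j).
Proof.
move=> pN; rewrite /wform (big_ord_widen N (fun j => a j * (p`_j * q`_j)))//.
rewrite [RHS](bigID (fun j : 'I_N => (j < size p)%N))/= [X in _ + X]big1 ?addr0//.
by move=> j; rewrite -leqNgt => jp; rewrite nth_default// mul0r mulr0.
Qed.

Lemma wformC a p q : wform a p q = wform a q p.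
Proof.
rewrite (wform_widen _ _ (leq_maxl (size p) (size q))).
rewrite (wform_widen _ _ (leq_maxr (size p) (size q))).
by apply: eq_bigr => j _; rewrite (mulrC p`_j).
Qed.

Lemma wformDr a p q r : wform a p (q + r) = wform a p q + wform a p r.
Proof. by rewrite /wform -big_split; apply: eq_bigr => j _ /=; rewrite coefD; ring. Qed.

Lemma wformZr a p (c : R) q : wform a p (c *: q) = c * wform a p q.
Proof. by rewrite /wform mulr_sumr; apply: eq_bigr => j _; rewrite coefZ; ring. Qed.

Lemma wformDl a p q r : wform a (q + r) p = wform a q p + wform a r p.
Proof. by rewrite wformC wformDr !(wformC _ p). Qed.

Lemma wformZl a p (c : R) q : wform a (c *: q) p = c * wform a q p.
Proof. by rewrite wformC wformZr (wformC _ p). Qed.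

Lemma wform0l a p : wform a 0 p = 0.
Proof. by rewrite /wform size_poly0 big_ord0. Qed.

Lemma wform_Xn a i j : wform a 'X^i 'X^j = if i == j then a i else 0.
Proof.
rewrite /wform size_polyXn big_ord_recr/= big1 ?add0r; last first.
  by move=> k _; rewrite coefXn ltn_eqF// mul0r mulr0.
by rewrite !coefXn eqxx mul1r; case: (i == j); rewrite ?mulr1 ?mulr0.
Qed.

Definition supported J p := forall j, p`_j != 0 -> J j.

Lemma supportedD J p q : supported J p -> supported J q -> supported J (p + q).
Proof.
move=> pJ qJ j; rewrite coefD; have [->|/pJ//] := eqVneq p`_j 0.
by rewrite add0r; exact: qJ.
Qed.

Lemma supportedZ J c p : supported J p -> supported J (c *: p).
Proof. by move=> pJ j; rewrite coefZ mulf_eq0 negb_or => /andP[_ /pJ]. Qed.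

Lemma supported0 J : supported J 0.
Proof. by move=> j; rewrite coef0 eqxx. Qed.

Lemma supported_Xn J j : J j -> supported J 'X^j.
Proof. by move=> Jj i; rewrite coefXn; case: (eqVneq i j) => [-> //|_]; rewrite eqxx. Qed.

Lemma wform_disjoint a J J' p q : J `&` J' = set0 -> supported J p ->
  supported J' q -> wform a p q = 0.
Proof.
move=> JJ' pJ qJ'; apply: big1 => j _.
have [->|/pJ Jj] := eqVneq p`_j 0; first by rewrite mul0r mulr0.
have [->|/qJ' J'j] := eqVneq q`_j 0; first by rewrite !mulr0.
by have : (J `&` J') j by []; rewrite JJ'.
Qed.

(** The part [I] of [y] is the diagonal of the diagonal operator with entries
    [x] in an orthonormal family that lives on the columns [J].  Keeping track of
    [J] lets disjoint sets of columns be used independently of each other. *)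
Definition realizable x y I J := exists u : nat -> {poly R},
  [/\ forall i, I i -> supported J (u i),
      forall i k, I i -> I k -> wform (fun=> 1) (u i) (u k) = (i == k)%:R
    & forall i, I i -> wform x (u i) (u i) = y i].

Lemma wformN x p q : wform (-%R \o x) p q = - wform x p q.
Proof. by rewrite /wform -sumrN; apply: eq_bigr => j _ /=; rewrite mulNr. Qed.

Lemma realizableN x y I J : realizable (-%R \o x) (-%R \o y) I J -> realizable x y I J.
Proof.
move=> [u [uJ uo ux]]; exists u; split=> // i Ii.
by apply: oppr_inj; rewrite -wformN ux.
Qed.

Lemma realizable_sub x y I I' J J' : I' `<=` I -> J `<=` J' -> realizable x y I J ->
  realizable x y I' J'.
Proof.
move=> II JJ [u [uJ uo ux]]; exists u; split=> [i /II /uJ sJ j /sJ/JJ//|i k /II Ii /II|i /II].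
  exact: uo.
exact: ux.
Qed.

(** Vectors on disjoint sets of columns are orthogonal. *)
Lemma realizableU x y I I' J J' : J `&` J' = set0 -> realizable x y I J ->
  realizable x y I' J' -> realizable x y (I `|` I') (J `|` J').
Proof.
move=> JJ' [u [uJ uo ux]] [u' [uJ' uo' ux']].
exists (fun i => if i \in I then u i else u' i).
have iI' i : (I `|` I') i -> i \notin I -> I' i.
  by move=> [Ii /negP|//]; rewrite inE.
split=> [i Ii|i k Ii Ik|i Ii].
- case: ifPn => [|/(iI' _ Ii) I'i]; first by rewrite inE => /uJ sJ j /sJ; left.
  by move=> j /(uJ' _ I'i); right.
- case: ifPn => [|iI]; case: ifPn => [|kI].
  + by rewrite !inE => Ik' Ii'; exact: uo.
  + rewrite inE => Ii'; rewrite (wform_disjoint _ JJ' (uJ _ Ii') (uJ' _ (iI' _ Ik kI))).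
    by case: eqVneq => // ik; move: kI; rewrite -ik => /negP[]; rewrite inE.
  + rewrite inE => Ik'.
    rewrite wformC (wform_disjoint _ JJ' (uJ _ Ik') (uJ' _ (iI' _ Ii iI))).
    by case: eqVneq => // ik; move: iI; rewrite ik => /negP[]; rewrite inE.
  + by apply: uo'; exact: iI'.
- case: ifPn => [|/(iI' _ Ii) I'i]; first by rewrite inE => /ux.
  exact: ux'.
Qed.

End FiniteVectors.

(** * Rotations inside a list of vectors *)

Section Rotations.
Variable R : realType.
Implicit Types (x y : nat -> R) (p q r : {poly R}) (I J : set nat) (v : nat -> {poly R}).

Definition jointly_diagonal x v := forall k l, k != l ->
  wform (fun=> 1) (v k) (v l) = 0 /\ wform x (v k) (v l) = 0.

(** One unit vector of the plane of [v k] and [v k.+1] is taken out of the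
    list; its orthogonal complement in this plane replaces both. *)
Definition rotate_drop v k (c s : R) : nat -> {poly R} := fun l =>
  if (l < k)%N then v l
  else if l == k then - s *: v k + c *: v k.+1 else v l.+1.

Lemma rotate_drop_perp a v k c s p : (forall l, wform a p (v l) = 0) ->
  forall l, wform a p (rotate_drop v k c s l) = 0.
Proof.
move=> pv l; rewrite /rotate_drop; case: ifP => // _; case: ifP => // _.
by rewrite wformDr !wformZr !pv !mulr0 addr0.
Qed.

Lemma rotate_drop_diagonal x v k c s : jointly_diagonal x v -> jointly_diagonal x (rotate_drop v k c s).
Proof.
move=> dv.
have half i j : (i < j)%N -> wform (fun=> 1) (rotate_drop v k c s i) (rotate_drop v k c s j) = 0 /\
    wform x (rotate_drop v k c s i) (rotate_drop v k c s j) = 0.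
  move=> ij; rewrite /rotate_drop.
  have [ik|ik|ik] := ltngtP i k.
  - have [jk|jk|jk] := ltngtP j k; first by apply: dv; lia.
      by apply: dv; lia.
    rewrite !wformDr !wformZr.
    have [-> ->] := dv i k ltac:(lia); have [-> ->] := dv i k.+1 ltac:(lia).
    by rewrite !mulr0 addr0.
  - have [jk|jk|jk] := ltngtP j k; [lia| |lia].
    by apply: dv; lia.
  - have [jk|jk|jk] := ltngtP j k; [lia| |lia].
    rewrite !wformDl !wformZl.
    have [-> ->] := dv k j.+1 ltac:(lia); have [-> ->] := dv k.+1 j.+1 ltac:(lia).
    by rewrite !mulr0 addr0.
move=> i j; have [ij _|ji _|//] := ltngtP i j; first exact: half.
by rewrite !(wformC _ (rotate_drop v k c s i)); exact: half.
Qed.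

(** Row n takes its vector out of two neighbours of the current list.  Later
    rows use combinations of the vectors that are left, to all of which the vector
    just taken is orthogonal.  The invariant [P] has to provide suitable
    neighbours. *)
Lemma rotation_process x y I J (P : nat -> (nat -> {poly R}) -> Prop) v0 :
  jointly_diagonal x v0 -> (forall k, supported J (v0 k)) -> P 0%N v0 ->
  (forall n v, ~ I n -> P n v -> P n.+1 v) ->
  (forall n v, jointly_diagonal x v -> P n v -> I n -> exists k c s,
     let p := c *: v k + s *: v k.+1 in
     [/\ wform (fun=> 1) p p = 1, wform x p p = y n,
         wform (fun=> 1) p (- s *: v k + c *: v k.+1) = 0
       & P n.+1 (rotate_drop v k c s)]) ->
  realizable x y I J.
Proof.
move=> d0 s0 P0 Pskip Pstep.
pose ok n v := [/\ jointly_diagonal x v, (forall k, supported J (v k)) & P n v].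
pose perp p v := forall l, wform (fun=> 1) p (v l) = 0.
have step n v : exists qv : {poly R} * (nat -> {poly R}), ok n v ->
    [/\ ok n.+1 qv.2, forall p, perp p v -> perp p qv.2
      & I n -> [/\ supported J qv.1, wform (fun=> 1) qv.1 qv.1 = 1,
          wform x qv.1 qv.1 = y n, perp qv.1 qv.2
        & forall p, perp p v -> wform (fun=> 1) p qv.1 = 0]].
  have [[dv sv Pv]|nok] := pselect (ok n v); last by exists (0, v) => /nok.
  have [In|nIn] := pselect (I n); last first.
    by exists (0, v) => _; split=> //; split=> //; exact: Pskip.
  have [k [c [s [p1 px pq Pn]]]] := Pstep n v dv Pv In.
  exists (c *: v k + s *: v k.+1, rotate_drop v k c s) => _ /=; split.
  - split=> //; first exact: rotate_drop_diagonal.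
    move=> l; rewrite /rotate_drop; case: ifP => // _; case: ifP => // _.
    by apply: supportedD; apply: supportedZ.
  - by move=> p pv; exact: rotate_drop_perp.
  - move=> _; split=> //; first by apply: supportedD; apply: supportedZ.
      move=> l; have [lk|lk] := eqVneq l k; first by rewrite lk /rotate_drop ltnn eqxx.
      rewrite wformDl !wformZl /rotate_drop (negPf lk); case: ifP => lk'.
        have [-> _] := dv k l ltac:(lia); have [-> _] := dv k.+1 l ltac:(lia).
        by rewrite !mulr0 addr0.
      have [-> _] := dv k l.+1 ltac:(lia); have [-> _] := dv k.+1 l.+1 ltac:(lia).
      by rewrite !mulr0 addr0.
    by move=> p pv; rewrite wformDr !wformZr !pv !mulr0 addr0.
have [f fP] := choice (fun nv : nat * (nat -> {poly R}) => step nv.1 nv.2).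
pose V := fix V n := if n is m.+1 then (f (m, V m)).2 else v0.
pose u n := (f (n, V n)).1.
have Vok n : ok n (V n) by elim: n => [//|n /(fP (n, V n))[]].
have Vperp n m p : perp p (V n) -> perp p (V (m + n)%N).
  by elim: m => [//|m IH] /IH; have [_ + _] := fP (_, _) (Vok (m + n)%N); apply.
have uP n : I n -> [/\ supported J (u n), wform (fun=> 1) (u n) (u n) = 1,
    wform x (u n) (u n) = y n, perp (u n) (V n.+1)
  & forall p, perp p (V n) -> wform (fun=> 1) p (u n) = 0].
  by move=> In; have [_ _ /(_ In)] := fP (n, V n) (Vok n).
have half i k : I i -> I k -> (i < k)%N -> wform (fun=> 1) (u i) (u k) = 0.
  move=> Ii Ik ik; have [_ _ _ _ ->//] := uP k Ik.
  by have [_ _ _ /(Vperp _ (k - i.+1)%N) + _] := uP i Ii; rewrite subnK.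
exists u; split=> [i /uP[]//|i k Ii Ik|i /uP[]//].
have [ik|ki|->] := ltngtP i k; first exact: half.
  by rewrite wformC; exact: half.
by have [] := uP k Ik.
Qed.

Definition diag_value x v k := wform x (v k) (v k).
Definition head_sum x v m := \sum_(k < m) diag_value x v k.

(** The trace on the plane of the two neighbours does not change, so the vector
    that stays has the sum of their values less the value taken out. *)
Lemma diag_value_rotate_drop x v k c s t l : jointly_diagonal x v -> c ^+ 2 + s ^+ 2 = 1 ->
  c ^+ 2 * diag_value x v k + s ^+ 2 * diag_value x v k.+1 = t ->
  diag_value x (rotate_drop v k c s) l = if (l < k)%N then diag_value x v l
    else if l == k then diag_value x v k + diag_value x v k.+1 - t else diag_value x v l.+1.
Proof.
move=> dv cs <-; rewrite /diag_value /rotate_drop; case: ifP => // _; case: ifP => // _.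
rewrite !wformDl !wformDr !wformZl !wformZr.
have [_ ->] := dv k k.+1 ltac:(lia); have [_ ->] := dv k.+1 k ltac:(lia).
have -> : s ^+ 2 = 1 - c ^+ 2 by rewrite -cs addrC addKr.
have -> : - s * (- s * wform x (v k) (v k)) = (1 - c ^+ 2) * wform x (v k) (v k).
  by rewrite -cs; ring.
ring.
Qed.

Lemma head_rotate_drop x v k c s t m : jointly_diagonal x v -> c ^+ 2 + s ^+ 2 = 1 ->
  c ^+ 2 * diag_value x v k + s ^+ 2 * diag_value x v k.+1 = t ->
  head_sum x (rotate_drop v k c s) m = if (m <= k)%N then head_sum x v m else head_sum x v m.+1 - t.
Proof.
move=> dv cs cy; elim: m => [|m IH]; first by rewrite /head_sum !big_ord0.
rewrite {1}/head_sum big_ord_recr/= -/(head_sum _ _ _) IH (diag_value_rotate_drop _ dv cs cy).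
have headS n : head_sum x v n.+1 = head_sum x v n + diag_value x v n by rewrite /head_sum big_ord_recr.
case: (ltngtP m k) => mk.
- by rewrite -headS.
- by rewrite (headS m.+1); ring.
- by rewrite mk !headS; ring.
Qed.

Lemma crossing_angle (a b t : R) : b <= t <= a -> exists c s : R,
  c ^+ 2 + s ^+ 2 = 1 /\ c ^+ 2 * a + s ^+ 2 * b = t.
Proof.
move=> /andP[bt ta]; have [ab|ba] := leP a b.
  exists 1, 0; split; first by rewrite expr1n expr0n/= addr0.
  by rewrite expr1n expr0n/= mul1r mul0r addr0; apply/eqP; rewrite eq_le ta (le_trans ab).
have d0 : 0 < a - b by rewrite subr_gt0.
exists (Num.sqrt ((t - b) / (a - b))), (Num.sqrt ((a - t) / (a - b))).
rewrite !sqr_sqrtr ?divr_ge0 ?subr_ge0// ?(ltW ba)//; split; field; lra.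
Qed.

End Rotations.

Section Lists.
Variable R : realType.
Implicit Types (x y : nat -> R) (p q r : {poly R}) (I J : set nat) (v : nat -> {poly R}).

Lemma rotated_pair x v k c s : jointly_diagonal x v ->
  let p := c *: v k + s *: v k.+1 in
  [/\ wform (fun=> 1) p p =
        c ^+ 2 * wform (fun=> 1) (v k) (v k) + s ^+ 2 * wform (fun=> 1) (v k.+1) (v k.+1),
      wform x p p = c ^+ 2 * diag_value x v k + s ^+ 2 * diag_value x v k.+1
    & wform (fun=> 1) p (- s *: v k + c *: v k.+1) =
        c * s * (wform (fun=> 1) (v k.+1) (v k.+1) - wform (fun=> 1) (v k) (v k))].
Proof.
move=> dv /=; rewrite /diag_value !wformDl !wformDr !wformZl !wformZr.
have [-> ->] := dv k k.+1 ltac:(lia); have [-> ->] := dv k.+1 k ltac:(lia).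
by split; ring.
Qed.

Lemma rotate_drop_unit x v k c s : jointly_diagonal x v -> c ^+ 2 + s ^+ 2 = 1 ->
  wform (fun=> 1) (v k) (v k) = 1 -> wform (fun=> 1) (v k.+1) (v k.+1) = 1 ->
  forall l, wform (fun=> 1) (rotate_drop v k c s l) (rotate_drop v k c s l) =
    if (l <= k)%N then (if (l < k)%N then wform (fun=> 1) (v l) (v l) else 1)
    else wform (fun=> 1) (v l.+1) (v l.+1).
Proof.
move=> dv cs vk vk1 l; rewrite /rotate_drop; case: ltngtP => // _.
rewrite !wformDl !wformDr !wformZl !wformZr vk vk1.
have [-> _] := dv k k.+1 ltac:(lia); have [-> _] := dv k.+1 k ltac:(lia).
by rewrite -[RHS]cs; ring.
Qed.

Lemma crossing_index (f : nat -> R) t N : t <= f 0%N -> f N.+1 <= t ->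
  exists k, (k <= N)%N /\ f k.+1 <= t <= f k.
Proof.
move=> f0 fN; have exk : exists k, f k.+1 <= t by exists N.
case: (ex_minnP exk) => k fk kmin; exists k; split; first exact: kmin.
rewrite fk; case: k kmin {fk} => [//|k] kmin.
by have [//|/ltW fkt] := leP t (f k.+1); have := kmin k fkt; rewrite ltnn.
Qed.

Definition basis_list (s : nat -> nat) : nat -> {poly R} := fun k => 'X^(s k).

Lemma basis_list_diagonal x s : injective s -> jointly_diagonal x (basis_list s).
Proof.
move=> si k l kl; rewrite /basis_list !wform_Xn.
by rewrite (inj_eq si) (negPf kl).
Qed.

(** Horn's argument for an infinite list.  The bound of the sum of m rows by the
    sum of the first m values survives a step at position k: the sums up to k do
    not change, and beyond k both sides lose the value of the row just served.
    Hence the values may come in any order, as long as every row meets values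
    below it again and again. *)
Lemma realizable_infinite_list x y I J (s : nat -> nat) :
  injective s -> (forall k, J (s k)) ->
  (forall G, uniq G -> (forall i, i \in G -> I i) ->
     \sum_(i <- G) y i <= \sum_(k < size G) x (s k)) ->
  (forall i, I i -> forall N, exists k, (N <= k)%N /\ x (s k) <= y i) ->
  realizable x y I J.
Proof.
move=> si sJ dom low.
pose P n v := [/\ forall k, wform (fun=> 1) (v k) (v k) = 1,
  forall G, uniq G -> (forall i, i \in G -> I i /\ (n <= i)%N) ->
     \sum_(i <- G) y i <= head_sum x v (size G)
  & forall i, I i -> (n <= i)%N -> forall N, exists k, (N <= k)%N /\ diag_value x v k <= y i].
apply: (@rotation_process _ x y I J P (basis_list s)).
- exact: basis_list_diagonal.
- by move=> k; exact: supported_Xn.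
- split=> [k|G Gu GI|i Ii _ N]; first by rewrite wform_Xn eqxx.
    have -> : head_sum x (basis_list s) (size G) = \sum_(k < size G) x (s k).
      by apply: eq_bigr => k _; rewrite /diag_value wform_Xn eqxx.
    by apply: dom => // i /GI[].
  have [k [Nk xk]] := low i Ii N; exists k; split=> //.
  by rewrite /diag_value wform_Xn eqxx.
- move=> n v nI [v1 vdom vlow]; split=> // [G Gu GI|i Ii ni].
    by apply: vdom => // i /GI[Ii /ltnW].
  by apply: vlow => //; exact: ltnW.
move=> n v dv [v1 vdom vlow] In.
have yn0 : y n <= diag_value x v 0.
  have := vdom [:: n] isT; rewrite big_seq1 /head_sum big_ord1; apply.
  by move=> i; rewrite inE => /eqP ->.
have [K [K0 xK]] := vlow n In (leqnn n) 1%N.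
case: K K0 xK => [//|N] _ xN.
have [k [_ kk]] := crossing_index yn0 xN.
have [c [t [ct cy]]] := crossing_angle kk.
have [p1 p2 p3] := rotated_pair k c t dv.
exists k, c, t => /=; split; first by rewrite p1 !v1 !mulr1.
- by rewrite p2.
- by rewrite p3 !v1 subrr mulr0.
split=> [l|G Gu GI|i Ii ni N'].
- by rewrite (rotate_drop_unit dv)//; do 2?case: ifP.
- rewrite (head_rotate_drop _ dv ct cy); case: ifP => Gk.
    by apply: vdom => // i /GI[Ii /ltnW].
  rewrite lerBrDr addrC; have := vdom (n :: G); rewrite big_cons; apply.
    by rewrite /= Gu andbT; apply/negP => /GI[_]; rewrite ltnn.
  by move=> i; rewrite inE => /predU1P[->//|/GI[Ii /ltnW]].
- have [l [Nl xl]] := vlow i Ii (ltnW ni) (N' + k + 3)%N.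
  exists l.-1; split; first by lia.
  rewrite (diag_value_rotate_drop _ dv ct cy) ltnNge (_ : (k <= l.-1)%N); last by lia.
  by rewrite (_ : l.-1 == k = false) ?prednK//; lia.
Qed.

(** In a finite list the lower bounds by the last values provide the values
    below each row; they survive a step for the same reason as the upper bounds.
    When a single value is left, it is the value of the last row. *)
Lemma realizable_finite_list x y I J (s : nat -> nat) n :
  {in [pred k | (k < n)%N] &, injective s} -> (forall k, (k < n)%N -> J (s k)) ->
  (forall G, uniq G -> (forall i, i \in G -> I i) ->
     [/\ (size G <= n)%N, \sum_(i <- G) y i <= \sum_(k < size G) x (s k)
       & \sum_(k < n) x (s k) - \sum_(k < n - size G) x (s k) <= \sum_(i <- G) y i]) ->
  realizable x y I J.
Proof.
move=> si sJ dom.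
pose v0 k : {poly R} := if (k < n)%N then 'X^(s k) else 0.
pose P m v := exists len, (forall k, (k < len)%N -> wform (fun=> 1) (v k) (v k) = 1) /\
  forall G, uniq G -> (forall i, i \in G -> I i /\ (m <= i)%N) ->
    [/\ (size G <= len)%N, \sum_(i <- G) y i <= head_sum x v (size G)
      & head_sum x v len - head_sum x v (len - size G) <= \sum_(i <- G) y i].
have headE m : (m <= n)%N -> head_sum x v0 m = \sum_(k < m) x (s k).
  move=> mn; apply: eq_bigr => k _.
  by rewrite /diag_value /v0 (leq_trans (ltn_ord k) mn) wform_Xn eqxx.
apply: (@rotation_process _ x y I J P v0).
- move=> k l kl; rewrite /v0; case: ifP => kn; last by rewrite !wform0l.
  case: ifP => ln; last by rewrite !(wformC _ 'X^_) !wform0l.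
  by rewrite !wform_Xn; case: eqVneq => // /si; rewrite !inE => /(_ kn ln) /eqP; rewrite (negPf kl).
- move=> k; rewrite /v0; case: ifP => [/sJ|_]; first exact: supported_Xn.
  exact: supported0.
- exists n; split=> [k kn|G Gu GI]; first by rewrite /v0 kn wform_Xn eqxx.
  have [Gn Gle Gge] := dom G Gu (fun i iG => (GI i iG).1).
  by split=> //; rewrite !headE ?leq_subr.
- move=> m v mI [len [v1 vdom]]; exists len; split=> // G Gu GI.
  by apply: vdom => // i /GI[Ii /ltnW].
move=> m v dv [len [v1 vdom]] Im.
have single i : i \in [:: m] -> I i /\ (m <= i)%N by rewrite inE => /eqP ->.
have [len1 ym0 ymlen] := vdom [:: m] isT single.
move: len len1 v1 vdom ymlen => [//|len] _ v1 vdom; rewrite subSS subn0.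
rewrite /head_sum big_ord_recr/= addrAC subrr add0r big_seq1 => ymlen.
move: ym0; rewrite /head_sum big_seq1 big_ord1 => ym0.
(* Both a rotation and the removal of the last value leave a list of length len. *)
have rotate_drop_ok k c t : (k < len)%N \/ k = len /\ diag_value x v k = y m ->
    c ^+ 2 + t ^+ 2 = 1 ->
    c ^+ 2 * diag_value x v k + t ^+ 2 * diag_value x v k.+1 = y m ->
    (forall l, (l < len)%N -> wform (fun=> 1) (rotate_drop v k c t l) (rotate_drop v k c t l) = 1) ->
    P m.+1 (rotate_drop v k c t).
  move=> klen ct cy u1; exists len; split=> // G Gu GI.
  have mG : m \notin G by apply/negP => /GI[_]; rewrite ltnn.
  have mGu : uniq (m :: G) by rewrite /= mG.
  have mGI i : i \in m :: G -> I i /\ (m <= i)%N.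
    by rewrite inE => /predU1P[->//|/GI[Ii /ltnW]].
  have GmI i : i \in G -> I i /\ (m <= i)%N by move=> /GI[Ii /ltnW].
  have [/= mGlen mGle mGge] := vdom _ mGu mGI.
  have [Glen Gle Gge] := vdom _ Gu GmI.
  rewrite big_cons in mGle; rewrite big_cons subSS in mGge.
  have -> : head_sum x (rotate_drop v k c t) len = head_sum x v len.+1 - y m.
    rewrite (head_rotate_drop _ dv ct cy); case: ifP => // lk.
    case: klen => [|[kl <-]]; first by rewrite ltnNge lk.
    by rewrite kl /head_sum big_ord_recr/= addrK.
  rewrite !(head_rotate_drop _ dv ct cy); split; first by lia.
    by case: ifP => // _; lra.
  case: ifP => Glk; first by lra.
  have E : (len.+1 - size G = (len - size G).+1)%N by rewrite subSn.
  by rewrite E in Gge; rewrite opprB addrA subrK.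
case: len => [|len] in v1 vdom ymlen rotate_drop_ok *.
  have ym : diag_value x v 0 = y m by apply/eqP; rewrite eq_le ymlen ym0.
  have [p1 p2 p3] := rotated_pair 0 1 0 dv.
  exists 0%N, 1, 0; split.
  - by rewrite p1 expr1n expr0n/= mul0r addr0 mul1r v1.
  - by rewrite p2 expr1n expr0n/= mul0r addr0 mul1r.
  - by rewrite p3 mulr0 mul0r.
  - apply: rotate_drop_ok => //; [by right|by rewrite expr1n expr0n addr0|].
    by rewrite expr1n expr0n/= mul0r addr0 mul1r.
have [k [klen kk]] := crossing_index ym0 ymlen.
have [c [t [ct cy]]] := crossing_angle kk.
have [p1 p2 p3] := rotated_pair k c t dv.
have vk : wform (fun=> 1) (v k) (v k) = 1 by apply: v1; lia.
have vk1 : wform (fun=> 1) (v k.+1) (v k.+1) = 1 by apply: v1; lia.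
exists k, c, t; split; first by rewrite p1 vk vk1 !mulr1.
- by rewrite p2.
- by rewrite p3 vk vk1 subrr mulr0.
apply: rotate_drop_ok => //; first by left.
move=> l ll; rewrite (rotate_drop_unit dv)//.
by case: ifP => lk; [case: ifP => // lk'; apply: v1; lia|apply: v1; lia].
Qed.

End Lists.

(** * Infinite sets of indices *)

Section InfiniteSets.
Implicit Types (A B : set nat).

Lemma infinite_set_ge A n : infinite_set A -> exists m, (n <= m)%N /\ A m.
Proof.
move=> Ainf; apply: contrapT => nA; apply: Ainf.
apply: (@sub_finite_set _ _ `I_n); last exact: finite_II.
by move=> m Am /=; rewrite ltnNge; apply/negP => nm; apply: nA; exists m.
Qed.

Lemma infinite_set_unbounded A : (forall n, exists m, (n <= m)%N /\ A m) -> infinite_set A.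
Proof.
move=> Age /finite_seqP[s As].
have [m [sm Am]] := Age (\max_(i <- s) i).+1.
have : m \in s by have : [set` s] m by rewrite -As.
move=> ms; have := @leq_bigmax_seq _ s xpredT id m ms isT; lia.
Qed.

(** Every choice is made larger than the preceding one. *)
Lemma injective_choice (A : nat -> set nat) : (forall n, infinite_set (A n)) ->
  exists f : nat -> nat, injective f /\ forall n, A n (f n).
Proof.
move=> Ai.
have [g gP] := choice (fun nb : nat * nat => infinite_set_ge nb.2 (Ai nb.1)).
pose f := fix f n := if n is m.+1 then g (n, (f m).+1) else g (0%N, 0%N).
have fS n : (f n < f n.+1)%N by have [] := gP (n.+1, (f n).+1).
exists f; split; last by case=> [|n]; [have [] := gP (0, 0)%N|have [] := gP (n.+1, (f n).+1)].
have fmono m n : (m < n)%N -> (f m < f n)%N.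
  by elim: n => // n IH; rewrite ltnS leq_eqVlt => /predU1P[->//|/IH/ltn_trans]; apply.
by move=> m n fmn; case: (ltngtP m n) => // /fmono; rewrite fmn ltnn.
Qed.

Lemma infinite_injection A (f : nat -> nat) : injective f -> (forall n, A (f n)) ->
  infinite_set A.
Proof.
move=> fi fA Af; apply: infinite_nat; have -> : [set: nat] = f @^-1` A.
  by apply/seteqP; split=> n //= _; exact: fA.
by apply: finite_preimage => // m n _ _ /fi.
Qed.

End InfiniteSets.

(** * Dominance and sorted lists *)

Section Dominance.
Variable R : realType.
Implicit Types (x y : nat -> R) (I J A : set nat) (F G : seq nat) (s e c t : R).

Lemma finite_argmax x A : finite_set A -> A !=set0 ->
  exists2 j, A j & forall k, A k -> x k <= x j.
Proof.
move=> /finite_seqP[F ->] [j0]; elim: F j0 => [//|i F IH] _ _.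
case: F IH => [_|k F /(_ k (mem_head _ _))[j jF jmax]].
  by exists i; rewrite /= ?inE// => k; rewrite inE => /eqP ->.
have [xij|xji] := leP (x i) (x j).
  exists j; first by rewrite /= inE jF orbT.
  by move=> l; rewrite /= inE => /predU1P[->//|/jmax].
exists i; first exact: mem_head.
by move=> l; rewrite /= inE => /predU1P[->//|/jmax/le_trans]; apply; exact: ltW.
Qed.

(** A largest remaining entry is picked repeatedly; it exists because only
    finitely many entries are above a given one. *)
Lemma descending_enumeration x A : infinite_set A ->
  (forall j, A j -> finite_set [set k | A k /\ x j <= x k]) ->
  exists f : nat -> nat, [/\ injective f, forall n, A (f n)
    & forall n k, A k -> (forall m, (m < n)%N -> k != f m) -> x k <= x (f n)].
Proof.
move=> Ai Af.
have next (F : seq nat) : exists j, [/\ A j, j \notin F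
    & forall k, A k -> k \notin F -> x k <= x j].
  have [j0 [Aj0 j0F]] : (A `\` [set` F]) !=set0.
    exact/infinite_setN0/infinite_setD/finite_seq.
  have [||j [Aj xj jF] jmax] :=
      @finite_argmax x [set k | [/\ A k, x j0 <= x k & k \notin F]].
  - by apply: sub_finite_set (Af j0 Aj0) => k [].
  - by exists j0; split=> //; apply/negP.
  exists j; split=> // k Ak kF; have [jk|/ltW kj] := leP (x j0) (x k); first exact: jmax.
  exact: le_trans kj xj.
have [g gP] := choice next.
pose h := fix h n := if n is m.+1 then g (h m) :: h m else [::].
have hS n : h n.+1 = g (h n) :: h n by [].
have hE n k : (k \in h n) <-> exists2 m, (m < n)%N & k = g (h m).
  elim: n k => [|n IH] k; first by split=> // -[].
  rewrite hS inE; split=> [/orP[/eqP ->|/IH[m mn ->]]|[m + ->]].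
  - by exists n.
  - by exists m => //; exact: leqW.
  - rewrite ltnS leq_eqVlt => /predU1P[->|mn]; first by rewrite eqxx.
    by apply/orP; right; apply/IH; exists m.
exists (fun n => g (h n)); split=> [m n gmn|n|n k Ak kn].
- case: (ltngtP m n) => // mn.
    have [_ /negP[]] := gP (h n); apply/hE; exists m => //; exact/esym.
  by have [_ /negP[]] := gP (h m); apply/hE; exists n.
- by have [] := gP (h n).
- have [_ _] := gP (h n); apply=> //; apply/negP => /hE[m mn] km.
  by have := kn m mn; rewrite km eqxx.
Qed.

(** The excesses of the rows in [I] over the level [s] are bounded by those of
    the columns in [J], with [e] to spare.  Where the sums over finite sets of
    columns are unbounded, as happens at levels below the upper limit of [x], the
    condition is void. *)
Definition dominated x y I J s e := forall B : R,
  (forall F, uniq F -> (forall j, j \in F -> J j) -> \sum_(j <- F) (x j - s) <= B) ->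
  forall G, uniq G -> (forall i, i \in G -> I i) -> \sum_(i <- G) (y i - s) + e <= B.

Lemma sum_excess_le x s F G : uniq F -> uniq G ->
  (forall j, j \in F -> j \notin G -> x j <= s) -> (forall j, j \in G -> s <= x j) ->
  \sum_(j <- F) (x j - s) <= \sum_(j <- G) (x j - s).
Proof.
move=> Fu Gu Fs Gs.
rewrite (bigID (mem G))/= [leRHS](bigID (mem F))/=.
have -> : \sum_(j <- F | j \in G) (x j - s) = \sum_(j <- G | j \in F) (x j - s).
  rewrite -big_filter -[RHS]big_filter; apply: perm_big; apply: uniq_perm.
  - exact: filter_uniq.
  - exact: filter_uniq.
  - by move=> j; rewrite !mem_filter/= andbC.
rewrite lerD2l; apply: (@le_trans _ _ 0).
  by rewrite big_seq_cond; apply: sumr_le0 => j /andP[jF jG]; rewrite subr_le0 Fs.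
by rewrite big_seq_cond; apply: sumr_ge0 => j /andP[jG _]; rewrite subr_ge0 Gs.
Qed.

Lemma sum_shift x s F : \sum_(j <- F) (x j - s) = \sum_(j <- F) x j - (size F)%:R * s.
Proof.
by rewrite big_split/= sumrN big_const_seq count_predT iter_addr addr0 mulr_natl.
Qed.

(** Each row gets two columns of its own, one with an entry above it and one
    with an entry below it, and its vector lies in their plane. *)
Lemma realizable_mid x y I J :
  (forall i, I i -> infinite_set [set j | J j /\ y i <= x j]) ->
  (forall i, I i -> infinite_set [set j | J j /\ x j <= y i]) ->
  realizable x y I J.
Proof.
move=> up low.
(* The terms 2i and 2i + 1 of the choice will be the two columns of row i. *)
pose A n := if odd n then [set j | I n./2 -> J j /\ x j <= y n./2]
            else [set j | I n./2 -> J j /\ y n./2 <= x j].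
have [|f [fi fA]] := @injective_choice A.
  move=> n; have [In|nIn] := pselect (I n./2); last first.
    have -> : A n = setT by rewrite /A; case: ifP => _; apply/seteqP; split=> // j _ /nIn.
    exact: infinite_nat.
  by rewrite /A; case: ifP => _; [apply: sub_infinite_set (low _ In)|
     apply: sub_infinite_set (up _ In)] => j jP _.
have fup i : I i -> J (f i.*2) /\ y i <= x (f i.*2).
  by have := fA i.*2; rewrite /A odd_double doubleK.
have flow i : I i -> J (f i.*2.+1) /\ x (f i.*2.+1) <= y i.
  by have := fA i.*2.+1; rewrite /A /= odd_double/= uphalf_double.
have /choice[g gP] : forall i, exists cs : R * R, I i -> cs.1 ^+ 2 + cs.2 ^+ 2 = 1 /\
    cs.1 ^+ 2 * x (f i.*2) + cs.2 ^+ 2 * x (f i.*2.+1) = y i.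
  move=> i; have [Ii|nIi] := pselect (I i); last by exists (0, 0) => /nIi.
  have [|c [s cs]] := @crossing_angle R (x (f i.*2)) (x (f i.*2.+1)) (y i).
    by rewrite (fup i Ii).2 (flow i Ii).2.
  by exists (c, s).
have f2 i k : (f i.*2 == f k.*2) = (i == k) by rewrite (inj_eq fi) (inj_eq double_inj).
have f3 i k : (f i.*2.+1 == f k.*2.+1) = (i == k).
  by rewrite (inj_eq fi) eqSS (inj_eq double_inj).
have f23 i k : (f i.*2 == f k.*2.+1) = false.
  by rewrite (inj_eq fi); apply/negP => /eqP; lia.
have f32 i k : (f i.*2.+1 == f k.*2) = false by rewrite eq_sym f23.
have wE a i k : wform a ((g i).1 *: 'X^(f i.*2) + (g i).2 *: 'X^(f i.*2.+1))
    ((g k).1 *: 'X^(f k.*2) + (g k).2 *: 'X^(f k.*2.+1)) =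
    if i == k then (g i).1 ^+ 2 * a (f i.*2) + (g i).2 ^+ 2 * a (f i.*2.+1) else 0.
  rewrite !wformDl !wformDr !wformZl !wformZr !wform_Xn f2 f3 f23 f32.
  by case: eqVneq => [->|_]; ring.
exists (fun i => (g i).1 *: 'X^(f i.*2) + (g i).2 *: 'X^(f i.*2.+1)); split.
- move=> i Ii; apply: supportedD; apply: supportedZ; apply: supported_Xn.
    by have [] := fup i Ii.
  by have [] := flow i Ii.
- move=> i k Ii Ik; rewrite wE; case: eqVneq => // _; rewrite !mulr1.
  by have [] := gP i Ii.
- by move=> i Ii; rewrite wE eqxx; have [] := gP i Ii.
Qed.

(** Different classes use disjoint sets of columns. *)
Lemma realizable_classes x y (D : R -> set R) :
  (forall r, D r r) -> (forall r r', D r r' -> D r' = D r) ->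
  (forall i, realizable x y [set k | D (y i) (y k)] [set j | D (y i) (x j)]) ->
  realizable x y setT setT.
Proof.
move=> Dr Dt sol.
have /choice[u uP] : forall C : set R, exists u : nat -> {poly R},
    forall i, D (y i) = C -> [/\ forall k, D (y k) = C -> supported [set j | C (x j)] (u k),
      forall k l, D (y k) = C -> D (y l) = C ->
        wform (fun=> 1) (u k) (u l) = (k == l)%:R
    & forall k, D (y k) = C -> wform x (u k) (u k) = y k].
  move=> C; have [[i0 DC]|noC] := pselect (exists i, D (y i) = C); last first.
    by exists (fun=> 0) => i DC; case: noC; exists i.
  have [u [uJ uo ux]] := sol i0.
  have CD k : D (y k) = C -> D (y i0) (y k) by move=> Dk; rewrite DC -Dk.
  exists u => i _; split=> [k /CD/uJ|k l /CD Dk /CD Dl|k /CD Dk].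
  - by rewrite DC.
  - exact: uo.
  - exact: ux.
exists (fun i => u (D (y i)) i); split=> [i _ j _ //|i k _ _|i _].
- have [ik|ik] := pselect (D (y i) = D (y k)).
    by rewrite ik; have [_ + _] := uP _ k erefl; apply.
  have [si _ _] := uP _ i erefl; have [sk _ _] := uP _ k erefl.
  rewrite (wform_disjoint _ _ (si i erefl) (sk k erefl)).
    by case: eqVneq => // ik'; case: ik; rewrite ik'.
  apply/seteqP; split=> // j [/= /Dt ij /Dt kj]; apply: ik; congruence.
- by have [_ _] := uP _ i erefl; apply.
Qed.

End Dominance.

Section SortedLists.
Variable R : realType.
Implicit Types (x y : nat -> R) (I J A : set nat) (F G : seq nat) (s e c t : R).

(** When the level [s] separates the entries in [T] from the others, the largest
    sum of excesses is the one over [T]. *)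
Lemma dominated_sum_le x y I J s (T : seq nat) G :
  dominated x y I J s 0 -> uniq T ->
  (forall j, J j -> j \notin T -> x j <= s) -> (forall j, j \in T -> s <= x j) ->
  uniq G -> (forall i, i \in G -> I i) -> size G = size T ->
  \sum_(i <- G) y i <= \sum_(j <- T) x j.
Proof.
move=> dom Tu Ts sT Gu GI GT.
have := dom (\sum_(j <- T) (x j - s)) _ G Gu GI.
rewrite addr0 !sum_shift GT lerD2r; apply=> F Fu FJ.
by rewrite -sum_shift; apply: sum_excess_le => // j /FJ; exact: Ts.
Qed.

Lemma sum_prefix x (f : nat -> nat) m :
  \sum_(k < m) x (f k) = \sum_(j <- [seq f k | k <- iota 0 m]) x j.
Proof. by rewrite big_map -(big_mkord predT (fun k => x (f k))) /index_iota subn0. Qed.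

(** All entries can be listed in decreasing order, and dominance at the level
    [x j] is the bound by the prefix of the list that ends at [j]. *)
Lemma realizable_descending x y I A : infinite_set A ->
  (forall j, A j -> finite_set [set k | A k /\ x j <= x k]) ->
  (forall i, I i -> exists2 j, A j & x j <= y i) ->
  (forall j, A j -> dominated x y I A (x j) 0) ->
  realizable x y I A.
Proof.
move=> Ai Af low dom; have [f [fi fA fmax]] := descending_enumeration Ai Af.
have fdesc k m : (k <= m)%N -> x (f m) <= x (f k).
  move=> km; apply: fmax => // l lk; rewrite (inj_eq fi); lia.
apply: (realizable_infinite_list fi fA) => [G Gu GI|i Ii N].
  case Gm : (size G) => [|m]; first by rewrite (size0nil Gm) big_nil big_ord0.
  rewrite (sum_prefix x f); apply: (dominated_sum_le (dom _ (fA m))) => //.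
  - by rewrite map_inj_uniq ?iota_uniq.
  - move=> j Aj jm; apply: fmax => // l lm; apply: contra jm => /eqP ->.
    by apply: map_f; rewrite mem_iota; lia.
  - by move=> j /mapP[k]; rewrite mem_iota => km ->; apply: fdesc; lia.
  - by rewrite size_map size_iota.
have [j Aj xj] := low i Ii.
apply: contrapT => nk; have := infinite_injection (A := [set k | A k /\ x j <= x k])
  (f := fun n => f (n + N)%N).
case=> [m n /fi|n|]; [lia| |exact: Af].
split=> //; have [//|fx] := leP (x j) (x (f (n + N)%N)).
by case: nk; exists (n + N)%N; split; [lia|exact: ltW (lt_le_trans fx xj)].
Qed.

Lemma finite_descending x A : finite_set A -> exists T : seq nat,
  [/\ uniq T, forall j, j \in T <-> A j
    & forall k m, (k <= m < size T)%N -> x (nth 0%N T m) <= x (nth 0%N T k)].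
Proof.
move=> /finite_seqP[F AF].
pose r : rel nat := fun j k => x k <= x j.
exists (sort r (undup F)); split=> [|j|k m /andP[km mT]].
- by rewrite sort_uniq undup_uniq.
- by rewrite mem_sort mem_undup AF.
- have rt : transitive r by move=> a b d /= ba da; exact: le_trans da ba.
  have rtot : total r by move=> a b; exact: le_total.
  have rr : reflexive r by move=> a; rewrite /r.
  have := sorted_leq_nth rt rr 0%N (sort_sorted rtot (undup F)).
  by apply=> //; rewrite inE; exact: leq_ltn_trans km mT.
Qed.

Lemma sum_take x (T : seq nat) m : (m <= size T)%N ->
  \sum_(k < m) x (nth 0%N T k) = \sum_(j <- take m T) x j.
Proof.
move=> mT; rewrite (big_nth 0%N) big_mkord size_takel//.
by apply: eq_bigr => k _; rewrite nth_take.
Qed.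

Lemma mem_take_nth (T : seq nat) m j : uniq T -> j \in T -> j \notin take m T ->
  exists2 k, (m <= k < size T)%N & j = nth 0%N T k.
Proof.
move=> Tu jT jm; exists (index j T); last by rewrite nth_index.
rewrite index_mem jT andbT leqNgt; apply: contra jm => jm.
by rewrite -(nth_index 0%N jT) -(nth_take _ jm) mem_nth// size_take; case: ifP; rewrite ?index_mem.
Qed.

Lemma dominated_take x y I J (T G : seq nat) :
  uniq T -> (forall j, j \in T <-> J j) ->
  (forall k m, (k <= m < size T)%N -> x (nth 0%N T m) <= x (nth 0%N T k)) ->
  (forall j, J j -> dominated x y I J (x j) 0) ->
  uniq G -> (forall i, i \in G -> I i) -> (size G <= size T)%N ->
  \sum_(i <- G) y i <= \sum_(k < size G) x (nth 0%N T k).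
Proof.
move=> Tu TJ Td dom Gu GI.
case Gm : (size G) => [|m] mT; first by rewrite (size0nil Gm) big_nil big_ord0.
rewrite sum_take//; apply: (dominated_sum_le (dom (nth 0%N T m) _)) => //.
- by apply/TJ; exact: mem_nth.
- exact: take_uniq.
- move=> j /TJ jT jm; have [k /andP[mk kT] ->] := mem_take_nth Tu jT jm.
  by apply: Td; lia.
- move=> j /(nthP 0%N)[k]; rewrite size_takel// => km <-.
  by rewrite nth_take//; apply: Td; lia.
- by rewrite size_takel.
Qed.

(** A finite decreasing list is continued by entries just below [c].  What they
    fall short of [c] is paid for by the slack at level [c]. *)
Lemma realizable_descending_tail x y I A c e (z : nat -> nat) : finite_set A ->
  (forall j, A j -> dominated x y I A (x j) 0) -> dominated x y I A c e ->
  (forall j, A j -> c <= x j) ->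
  injective z -> (forall k, ~ A (z k)) -> (forall k, x (z k) <= c) ->
  (forall n, \sum_(k < n) (c - x (z k)) <= e) ->
  (forall i, I i -> c <= y i) ->
  realizable x y I (A `|` range z).
Proof.
move=> Af dom domc Ac zi zA zc ze yc.
have [T [Tu TA Td]] := finite_descending x Af.
pose f k := if (k < size T)%N then nth 0%N T k else z (k - size T)%N.
have fT k : (k < size T)%N -> f k = nth 0%N T k by rewrite /f => ->.
have fz k : f (size T + k)%N = z k by rewrite /f ltnNge leq_addr/= addKn.
have TzF k m : (k < size T)%N -> nth 0%N T k <> z m.
  by move=> kT kz; apply: (zA m); rewrite -kz; apply/TA; exact: mem_nth.
apply: (@realizable_infinite_list _ _ _ _ _ f).
- move=> k m; rewrite /f; case: ltnP => kT; case: ltnP => mT.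
  + by move/eqP; rewrite nth_uniq// => /eqP.
  + by move/TzF => /(_ kT).
  + by move/esym/TzF => /(_ mT).
  + by move/zi; lia.
- move=> k; rewrite /f; case: ltnP => kT; [left|right; exists (k - size T)%N => //].
  by apply/TA; exact: mem_nth.
- move=> G Gu GI; have [GT|TG] := leqP (size G) (size T).
    rewrite (eq_bigr (fun k : 'I__ => x (nth 0%N T k))); last first.
      by move=> k _; rewrite fT// (leq_trans (ltn_ord k)).
    exact: (dominated_take Tu TA Td dom).
  rewrite -(subnKC (ltnW TG)) big_split_ord/=.
  rewrite (eq_bigr (fun k : 'I__ => x (nth 0%N T k))); last by move=> k _; rewrite fT.
  rewrite sum_take// take_size.
  under [X in _ + X]eq_bigr do rewrite fz.
  have Tbound F : uniq F -> (forall j, j \in F -> A j) ->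
      \sum_(j <- F) (x j - c) <= \sum_(j <- T) (x j - c).
    move=> Fu FA; apply: sum_excess_le => //; first by move=> j /FA /TA ->.
    by move=> j /TA /Ac.
  have := domc _ Tbound G Gu GI; have := ze (size G - size T)%N.
  rewrite big_split/= sumrN sumr_const card_ord -mulr_natl natrB; last exact: ltnW.
  by rewrite !sum_shift; lra.
- move=> i Ii N; exists (size T + N)%N; split; first by lia.
  by rewrite fz (le_trans (zc N))// yc.
Qed.

(** The Schur-Horn theorem.  Dominance at very low levels implies that there are
    at most as many rows as columns. *)
Lemma realizable_finite x y I J : finite_set J ->
  (forall s, dominated x y I J s 0) ->
  (forall s, dominated (-%R \o x) (-%R \o y) I J s 0) ->
  realizable x y I J.
Proof.
move=> Jf dom domN; have [T [Tu TJ Td]] := finite_descending x Jf.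
apply: (@realizable_finite_list _ x y I J (nth 0%N T) (size T)).
- by move=> k m; rewrite !inE => kT mT /eqP; rewrite nth_uniq// => /eqP.
- by move=> k kT; apply/TJ; exact: mem_nth.
move=> G Gu GI.
have GT : (size G <= size T)%N.
  rewrite leqNgt; apply/negP => TG.
  pose D := \sum_(j <- T) x j - \sum_(i <- G) y i.
  (* A level below all entries, and so low that an extra row could not be paid for. *)
  pose s := \big[Num.min/(- `|D| - 1)]_(j <- T) x j.
  have sx j : j \in T -> s <= x j by move=> jT; exact: ge_bigmin_seq.
  have sD : s <= - `|D| - 1 by exact: bigmin_le_id.
  have Tbound F : uniq F -> (forall j, j \in F -> J j) ->
      \sum_(j <- F) (x j - s) <= \sum_(j <- T) (x j - s).
    by move=> Fu FJ; apply: sum_excess_le => // j /FJ /TJ ->.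
  have := dom s _ Tbound G Gu GI; rewrite addr0 !sum_shift.
  rewrite -(subnKC TG) natrD -addn1 natrD.
  have d0 := ler0n R (size G - (size T).+1).
  have := ler_norm D; have := ler_wpM2l d0 sD; have := mulr_ge0 d0 (normr_ge0 D).
  move: (normr_ge0 D) sD d0; rewrite mulrBr mulr1 mulrN !mulrDl mul1r addn1.
  by rewrite /D; lra.
split=> //; first exact: (dominated_take Tu TJ Td (fun j _ => dom (x j))).
rewrite !sum_take ?leq_subr// take_size -{1}(cat_take_drop (size T - size G) T) big_cat/=.
rewrite addrAC subrr add0r.
case Gm : (size G) => [|m]; first by rewrite (size0nil Gm) big_nil subn0 drop_size big_nil.
rewrite -lerN2 -!sumrN.
have T0 : (size T - m.+1 < size T)%N by lia.
apply: (dominated_sum_le (domN (- x (nth 0%N T (size T - m.+1))))) => //.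
- exact: drop_uniq.
- move=> j /TJ jT jd; rewrite /= lerN2.
  have jt : j \in take (size T - m.+1) T.
    by move: jT; rewrite -{1}(cat_take_drop (size T - m.+1) T) mem_cat (negPf jd) orbF.
  move: jt => /(nthP 0%N)[k]; rewrite size_takel ?leq_subr// => km <-.
  by rewrite nth_take//; apply: Td; lia.
- move=> j /(nthP 0%N)[k]; rewrite size_drop => km <-.
  by rewrite /= lerN2 nth_drop; apply: Td; rewrite leq_addr -ltn_subRL.
- by rewrite size_drop Gm subKn// -Gm.
Qed.

End SortedLists.

(** * Rows and entries near the upper and lower limits *)

Section Blocks.
Variable R : realType.
Implicit Types (x y : nat -> R) (I J A Z : set nat) (F G : seq nat) (s e c d t : R).

Lemma dominated_rows x y I I' J s e : I' `<=` I ->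
  dominated x y I J s e -> dominated x y I' J s e.
Proof. by move=> II dom B FB G Gu GI; apply: dom => // i /GI/II. Qed.

Lemma dominated_weaken x y I J s e e' : e' <= e ->
  dominated x y I J s e -> dominated x y I J s e'.
Proof.
by move=> ee dom B FB G Gu GI; apply: le_trans (dom B FB G Gu GI); rewrite lerD2l.
Qed.

(** Columns can be removed at the price of the excess that they carry. *)
Lemma dominated_sparse x y I J A s e e' :
  (forall F, uniq F -> (forall j, j \in F -> J j /\ ~ A j) -> \sum_(j <- F) (x j - s) <= e') ->
  dominated x y I J s e -> dominated x y I A s (e - e').
Proof.
move=> FZ dom B FB G Gu GI; rewrite addrA lerBlDr; apply: dom => // F Fu FJ.
rewrite (bigID (fun j => `[< A j >]))/= -!(big_filter F); apply: lerD.
  apply: FB; first exact: filter_uniq.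
  by move=> j; rewrite mem_filter => /andP[/asboolP].
apply: FZ; first exact: filter_uniq.
by move=> j; rewrite mem_filter => /andP[/asboolP nA /FJ].
Qed.

Lemma dominated_restrict x y I J A s e : (forall j, J j -> ~ A j -> x j <= s) ->
  dominated x y I J s e -> dominated x y I A s e.
Proof.
move=> JA dom; rewrite -[e]subr0; apply: dominated_sparse dom => F Fu FJ.
by rewrite big_seq; apply: sumr_le0 => j /FJ[Jj nAj]; rewrite subr_le0 JA.
Qed.

Lemma half_powers_small e d : 0 < d -> exists N, forall n, (N <= n)%N -> e / 2 ^+ n.+1 <= d.
Proof.
move=> d0; exists (Num.truncn (`|e| / d)).+1 => n Nn.
rewrite ler_pdivrMr ?exprn_gt0//; apply: le_trans (ler_norm e) _.
rewrite mulrC -ler_pdivrMr//; have /ltW/le_trans := truncnS_gt (`|e| / d); apply.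
apply: (@le_trans _ _ n%:R); first by rewrite ler_nat.
by rewrite -natrX ler_nat; apply: ltnW; apply: ltnW; exact: ltn_expl.
Qed.

Lemma sum_half_powers e N : 0 <= e -> \sum_(k < N) e / 2 ^+ k.+1 <= e.
Proof.
move=> e0; have -> : \sum_(k < N) e / 2 ^+ k.+1 = e * (1 - 2 ^- N).
  elim: N => [|N IH]; first by rewrite big_ord0 expr0 invr1 subrr mulr0.
  by rewrite big_ord_recr/= IH exprS; field; rewrite ?expf_neq0.
by rewrite ler_piMr// gerBl invr_ge0 exprn_ge0.
Qed.

Lemma sum_over_range (g : nat -> R) (z : nat -> nat) e F : injective z ->
  (forall n, 0 <= g (z n)) -> (forall n, \sum_(k < n) g (z k) <= e) ->
  uniq F -> (forall j, j \in F -> range z j) -> \sum_(j <- F) g j <= e.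
Proof.
move=> zi g0 ge Fu Fz.
have [F' FE] : exists F', F = [seq z n | n <- F'].
  elim: F Fz {Fu} => [|j F IH] Fz; first by exists [::].
  have [|F' ->] := IH; first by move=> k kF; apply: Fz; rewrite inE kF orbT.
  by have [n _ <-] := Fz j (mem_head _ _); exists (n :: F').
move: Fu; rewrite FE (map_inj_uniq zi) big_map => F'u.
pose N := (\max_(n <- F') n).+1.
apply: le_trans (ge N); rewrite -(big_mkord predT (fun n => g (z n))).
have F'N n : n \in F' -> n \in index_iota 0 N.
  by move=> nF; rewrite mem_index_iota/= ltnS; exact: (@leq_bigmax_seq _ F' xpredT id).
rewrite [leRHS](bigID (mem F'))/= -[leLHS]addr0 lerD//; last first.
  by apply: sumr_ge0 => n _; exact: g0.
rewrite -[leRHS]big_filter le_eqVlt; apply/orP; left; apply/eqP/perm_big/uniq_perm => //.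
  by rewrite filter_uniq// iota_uniq.
by move=> n; rewrite mem_filter/=; case nF: (n \in F') => //=; rewrite F'N.
Qed.

(** The upper limit [c] of the entries in [J], in a situation where columns near
    [c] can be spared: copies of [c] contribute nothing to the excesses over the
    levels from [c] on, and other entries close to [c] are paid for by the
    slack [e]. *)
Definition upper_edge x y I J c :=
  [/\ forall s, c < s -> finite_set [set j | J j /\ s <= x j],
      forall d, 0 < d -> infinite_set [set j | J j /\ `|x j - c| < d],
      forall s, c <= s -> dominated x y I J s 0
    & infinite_set [set j | J j /\ x j = c] \/
      exists e t, [/\ 0 < e, c < t & forall s, c <= s <= t -> dominated x y I J s e]].

(** The rows [I'] are served from the columns [J'], and each other row keeps
    infinitely many entries above it and loses only finitely many below it.  The
    last three conditions make sure that the lower edge of the problem survives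
    the removal of [J']. *)
Definition upper_part x y I J c d I' J' :=
  [/\ [/\ I' `<=` I, J' `<=` J & realizable x y I' J'],
      forall i, (I `\` I') i -> infinite_set [set j | (J `\` J') j /\ y i <= x j] /\
        finite_set [set j | J' j /\ x j <= y i],
      forall F, uniq F -> (forall j, j \in F -> J' j /\ x j <= c) ->
        \sum_(j <- F) (c - x j) <= d,
      infinite_set [set j | J j /\ x j = c] ->
        (forall j, J' j -> c <= x j) /\
        infinite_set [set j | (J `\` J') j /\ x j = c]
    & forall e, 0 < e -> infinite_set [set j | (J `\` J') j /\ `|x j - c| < e]].

(** With infinitely many entries above [c], the rows above [c] use them in
    decreasing order; the reserve [Z] is left to the other rows. *)
Lemma upper_part_reserve x y I J c d Z : 0 <= d -> upper_edge x y I J c -> infinite_set Z ->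
  (forall j, Z j -> J j /\ c <= x j) ->
  infinite_set [set j | [/\ J j, c < x j & ~ Z j]] ->
  (forall s, c < s -> dominated x y I [set j | [/\ J j, c < x j & ~ Z j]] s 0) ->
  exists I' J', upper_part x y I J c d I' J'.
Proof.
move=> d0 [E1 _ _ _] Zi ZJ Ai dom.
set A := [set j | _] in Ai dom.
exists [set i | I i /\ c < y i], A; split.
- split=> [i []//|j []//|]; apply: realizable_descending => //.
  + move=> j [Jj cj _]; apply: sub_finite_set (E1 _ cj) => k [[Jk _ _]]; split=> //.
  + move=> i [Ii ci]; have [j [Aj /= nj]] := infinite_setN0 (infinite_setD Ai (E1 _ ci)).
    exists j => //; rewrite leNgt; apply/negP => /ltW yx; apply: nj; split=> //.
    by case: Aj.
  + by move=> j [Jj cj _]; apply: dominated_rows (dom _ cj) => i [].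
- move=> i [Ii nI']; have yc : y i <= c by rewrite leNgt; apply/negP => ci; apply: nI'.
  split; first apply: sub_infinite_set Zi => j Zj.
    have [Jj cj] := ZJ j Zj.
    by split; [split=> // -[_ _]|exact: le_trans cj].
  rewrite (_ : [set j | _] = set0)//; apply/seteqP; split=> // j [[_ cj _] jy].
  by have := le_lt_trans (le_trans jy yc) cj; rewrite ltxx.
- case=> [|j F] _ FA; first by rewrite big_nil.
  have [[_ cj _] jc] := FA j (mem_head _ _).
  by have := lt_le_trans cj jc; rewrite ltxx.
- move=> copies; split=> [j [_ /ltW]//|].
  apply: sub_infinite_set copies => j [Jj xj]; split=> //; split=> // -[_].
  by rewrite xj ltxx.
- move=> e e0; have ce : c < c + e by rewrite ltrDl.
  apply: sub_infinite_set (infinite_setD Zi (E1 _ ce)) => j [Zj nj].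
  have [Jj cj] := ZJ j Zj; split; first by split=> // -[_ _].
  rewrite ger0_norm ?subr_ge0// ltrBlDl ltNge; apply/negP => cej; exact: nj.
Qed.

(** With finitely many entries above [c], their list is continued by every
    second term of a sequence that tends to [c] from below; the other terms are
    left to the rows below [c]. *)
Lemma upper_part_tail x y I J c d e (z : nat -> nat) : upper_edge x y I J c ->
  finite_set [set j | J j /\ c < x j] -> 0 <= e -> e <= d ->
  dominated x y I J c e -> injective z -> (forall n, J (z n)) ->
  (forall n, 0 <= c - x (z n) <= e / 2 ^+ n.+1) ->
  (infinite_set [set j | J j /\ x j = c] -> forall n, x (z n) = c) ->
  exists I' J', upper_part x y I J c d I' J'.
Proof.
move=> [E1 _ E3 _] Af e0 ed dom zi zJ zc copies_z.
set A := [set j | _] in Af.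
have z2i : injective (fun n => z n.*2) by move=> m n /zi/double_inj.
have z3i N : injective (fun n => z (n + N).*2.+1) by move=> m n /zi /succn_inj/double_inj/addIn.
have zc0 n : x (z n) <= c by have /andP[+ _] := zc n; rewrite subr_ge0.
have nAz n : ~ A (z n) by move=> [_]; rewrite ltNge zc0.
have z2sum n : \sum_(k < n) (c - x (z k.*2)) <= e.
  apply: le_trans (sum_half_powers n e0); apply: ler_sum => k _.
  have /andP[_ /le_trans] := zc k.*2; apply.
  apply: ler_wpM2l => //; rewrite lef_pV2 ?posrE ?exprn_gt0//.
  by apply: ler_weXn2l; rewrite ?ler1n// ltnS -addnn leq_addr.
have odd_free k : (J `\` (A `|` range (fun n => z n.*2))) (z k.*2.+1).
  by split=> // -[/nAz//|[m _ /zi/(congr1 odd)]]; rewrite /= !odd_double.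
have later n N : (N <= (n + N).*2.+1)%N by rewrite -addnn; lia.
have small t : 0 < t -> exists N, forall n, (N <= n)%N -> c - x (z n) <= t.
  move=> t0; have [N NP] := half_powers_small e t0; exists N => n /NP.
  by have /andP[_ /le_trans] := zc n; apply.
exists [set i | I i /\ c <= y i], (A `|` range (fun n => z n.*2)); split.
- split=> [i []//|j [[]//|[n _ <-]]//|].
  apply: (@realizable_descending_tail _ _ _ _ _ c e) => //.
  + move=> j [Jj cj]; apply: dominated_rows (_ : dominated _ _ I _ _ _); first by move=> i [].
    apply: dominated_restrict (E3 _ (ltW cj)) => k Jk nAk.
    by rewrite (le_trans _ (ltW cj))// leNgt; apply/negP => ck; apply: nAk.
  + apply: dominated_rows (_ : dominated _ _ I _ _ _); first by move=> i [].
    apply: dominated_restrict dom => k Jk nAk.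
    by rewrite leNgt; apply/negP => ck; apply: nAk.
  + by move=> j [_ /ltW].
  + by move=> i [].
- move=> i [Ii nI']; have yc : 0 < c - y i.
    by rewrite subr_gt0 ltNge; apply/negP => ci; apply: nI'.
  have [N zN] := small _ yc; split.
    apply: (infinite_injection (z3i N)) => n; split; first exact: odd_free.
    by have := zN (n + N).*2.+1 (later n N); lra.
  have [M zM] := small ((c - y i) / 2) ltac:(by rewrite divr_gt0).
  apply: (@sub_finite_set _ _ (z @` `I_M)); last exact/finite_image/finite_II.
  move=> j [[[_ cj]|[n _ <-]] jy]; first by lra.
  exists n.*2 => //=; rewrite ltnNge; apply/negP => /zM; lra.
- move=> F Fu FA.
  apply: le_trans ed; apply: (sum_over_range (g := fun j => c - x j) z2i) => //.
    by move=> n; rewrite subr_ge0.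
  move=> j /FA[[[_ cj]|//] jc].
  by have := lt_le_trans cj jc; rewrite ltxx.
- move=> copies; have zE := copies_z copies; split.
    by move=> j [[_ /ltW//]|[n _ <-]]; rewrite zE.
  by apply: (infinite_injection (z3i 0%N)) => n; split; [exact: odd_free|exact: zE].
- move=> t t0; have [N zN] := small (t / 2) ltac:(by rewrite divr_gt0).
  apply: (infinite_injection (z3i N)) => n; split; first exact: odd_free.
  have := zc0 (n + N).*2.+1; have := zN (n + N).*2.+1 (later n N).
  by rewrite ltr_norml; lra.
Qed.

(** The columns that are spared are copies of [c], if there are infinitely many;
    otherwise they tend to [c] so fast that the slack, and in the finite case also
    the prescribed cost [d], covers them. *)
Lemma upper_part_exists x y I J c d : upper_edge x y I J c -> 0 < d ->
  exists I' J', upper_part x y I J c d I' J'.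
Proof.
move=> Ec d0; have [E1 E2 E3 E4] := Ec.
have [Af|Ai] := pselect (finite_set [set j | J j /\ c < x j]).
  have [copies|nocopies] := pselect (infinite_set [set j | J j /\ x j = c]).
    have [z [zi zP]] := injective_choice (fun _ : nat => copies).
    apply: (@upper_part_tail _ _ _ _ _ _ 0 z) => //; [exact: ltW|exact: E3|..].
    - by move=> n; have [] := zP n.
    - by move=> n; have [_ ->] := zP n; rewrite subrr mul0r lexx.
    - by move=> _ n; have [] := zP n.
  have [//|[e [t [e0 ct dom]]]] := E4.
  (* The columns z must respect both the slack e and the prescribed cost d. *)
  pose e' := Num.min e d.
  have e'0 : 0 < e' by rewrite lt_min e0.
  have near n : infinite_set [set j | J j /\ 0 <= c - x j <= e' / 2 ^+ n.+1].
    have p0 : 0 < e' / 2 ^+ n.+1 by rewrite divr_gt0 ?exprn_gt0.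
    apply: sub_infinite_set (infinite_setD (E2 _ p0) Af) => j [[Jj jn] nj].
    have xc : x j <= c by rewrite leNgt; apply/negP => cx; apply: nj.
    by split=> //; rewrite subr_ge0 xc -[leLHS]ger0_norm ?subr_ge0// distrC ltW.
  have [z [zi zP]] := injective_choice near.
  apply: (@upper_part_tail _ _ _ _ _ _ e' z) => //; [exact: ltW|..].
  - by rewrite ge_min lexx orbT.
  - by apply: dominated_weaken (dom c _); rewrite ?ge_min ?lexx//= ltW.
  - by move=> n; have [] := zP n.
  - by move=> n; have [] := zP n.
have [copies|nocopies] := pselect (infinite_set [set j | J j /\ x j = c]).
  apply: (@upper_part_reserve _ _ _ _ _ _ _ (ltW d0) Ec copies).
  - by move=> j [Jj ->].
  - by apply: sub_infinite_set Ai => j [Jj cj]; split=> // -[_ xj]; rewrite xj ltxx in cj.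
  - move=> s cs; apply: dominated_restrict (E3 _ (ltW cs)) => j Jj nj.
    rewrite (le_trans _ (ltW cs))// leNgt; apply/negP => cj; apply: nj; split=> // -[_ xj].
    by rewrite xj ltxx in cj.
have [//|[e [t [e0 ct dom]]]] := E4.
have near n : infinite_set [set j | [/\ J j, c < x j, x j < t & x j - c <= e / 2 ^+ n.+1]].
  have p0 : c < Num.min t (c + e / 2 ^+ n.+1).
    by rewrite lt_min ct ltrDl divr_gt0 ?exprn_gt0.
  apply: sub_infinite_set (infinite_setD Ai (E1 _ p0)) => j [[Jj cj] nj].
  have : x j < Num.min t (c + e / 2 ^+ n.+1) by rewrite ltNge; apply/negP => xj; apply: nj.
  by rewrite lt_min => /andP[xt /ltW xe]; split=> //; rewrite lerBlDl.
have [z [zi zP]] := injective_choice near.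
have z2i : injective (fun n => z n.*2) by move=> m n /zi/double_inj.
pose Z := range (fun n => z n.*2).
apply: (@upper_part_reserve _ _ _ _ _ _ Z (ltW d0) Ec).
- by apply: (infinite_injection z2i) => n; exists n.
- by move=> _ [n _ <-]; have [Jz /ltW cz _ _] := zP n.*2.
- apply: (@infinite_injection _ (fun n => z n.*2.+1)); first by move=> m n /zi[]/double_inj.
  move=> n; have [Jz cz _ _] := zP n.*2.+1; split=> //.
  by move=> [m _ /zi/(congr1 odd)]; rewrite /= !odd_double.
move=> s cs; have [st|ts] := leP s t; last first.
  apply: dominated_restrict (E3 _ (ltW cs)) => j Jj nj.
  have [jc|cj] := leP (x j) c; first exact: le_trans jc (ltW cs).
  have [n _ <-] : Z j by apply: contrapT => nZj; apply: nj.
  by have [_ _ xt _] := zP n.*2; exact: ltW (lt_trans xt ts).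
apply: (@dominated_restrict _ _ _ [set j | J j /\ ~ Z j]) => [j [Jj nZ] nj|].
  by rewrite (le_trans _ (ltW cs))// leNgt; apply/negP => cj; apply: nj.
rewrite -(subrr e); apply: dominated_sparse (dom s _); last by rewrite (ltW cs).
move=> F Fu FJ; apply: (@le_trans _ _ (\sum_(j <- F) (x j - c))).
  by apply: ler_sum => j _; rewrite lerD2l lerN2 ltW.
apply: (sum_over_range (g := fun j => x j - c) z2i) => //.
- by move=> n; have [_ /ltW + _ _] := zP n.*2; rewrite subr_ge0.
- move=> n; apply: le_trans (sum_half_powers n (ltW e0)); apply: ler_sum => k _.
  have [_ _ _ /le_trans] := zP k.*2; apply.
  apply: ler_wpM2l; first exact: ltW.
  rewrite lef_pV2 ?posrE ?exprn_gt0//.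
  by apply: ler_weXn2l; rewrite ?ler1n// ltnS -addnn leq_addr.
- by move=> j /FJ[Jj nj]; apply: contrapT => nZj; apply: nj.
Qed.

(** Once the rows at the upper edge are served, the others have infinite
    supplies on both sides. *)
Lemma realizable_edge_lower x y I J c : upper_edge x y I J c ->
  (forall i, I i -> infinite_set [set j | J j /\ x j <= y i]) -> realizable x y I J.
Proof.
move=> Ec low; have [I' [J' [[II JJ sol] rest _ _ _]]] := upper_part_exists Ec ltr01.
have mid : realizable x y (I `\` I') (J `\` J').
  apply: realizable_mid => i Ii; have [up fin] := rest i Ii; first exact: up.
  apply: sub_infinite_set (infinite_setD (low i Ii.1) fin) => j [[Jj xj] nj].
  by split=> //; split=> // J'j; apply: nj.
apply: realizable_sub (realizableU _ sol mid).
- by move=> i Ii; have [I'i|nI'i] := pselect (I' i); [left|right].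
- by move=> j [/JJ//|[]].
- by apply/seteqP; split=> // j [J'j []].
Qed.

Lemma edges_ordered x y I J c c' : upper_edge x y I J c ->
  upper_edge (-%R \o x) (-%R \o y) I J (- c') -> c' <= c.
Proof.
move=> [E1 E2 _ _] [F1 _ _ _]; rewrite leNgt; apply/negP => cc.
have m1 : c < (c + c') / 2 by lra.
have m2 : - c' < - ((c + c') / 2) by lra.
have := infinite_setD (infinite_setD (E2 1 ltr01) (E1 _ m1)) (F1 _ m2).
move=> /infinite_setN0[j [[[Jj _] nu] nl]]; have [xm|mx] := leP ((c + c') / 2) (x j).
  by apply: nu.
by apply: nl; split=> //=; rewrite lerN2 ltW.
Qed.

(** The upper edge is served at a cost so small that the lower edge survives;
    then the preceding lemma applies with all signs changed. *)
Lemma realizable_edges x y I J c c' : upper_edge x y I J c ->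
  upper_edge (-%R \o x) (-%R \o y) I J (- c') -> realizable x y I J.
Proof.
move=> Ec Ec'; have cc := edges_ordered Ec Ec'.
have [F1 F2 F3 F4] := Ec'.
have remain d I' J' : upper_part x y I J c d I' J' ->
    upper_edge (-%R \o x) (-%R \o y) (I `\` I') (J `\` J') (- c') -> realizable x y I J.
  move=> [[II JJ sol] rest _ _ _] E'.
  have sol' : realizable x y (I `\` I') (J `\` J').
    apply/realizableN/(realizable_edge_lower E') => i Ii.
    by have [up _] := rest i Ii; apply: sub_infinite_set up => j [Jj yx]; split=> //=; rewrite lerN2.
  apply: realizable_sub (realizableU _ sol sol').
  - by move=> i Ii; have [I'i|nI'i] := pselect (I' i); [left|right].
  - by move=> j [/JJ//|[]].
  - by apply/seteqP; split=> // j [J'j []].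
have keep I' J' : (forall j, J' j -> c' <= x j) ->
    (forall d, 0 < d -> infinite_set [set j | (J `\` J') j /\ `|x j - c'| < d]) ->
    (infinite_set [set j | J j /\ x j = c'] ->
      infinite_set [set j | (J `\` J') j /\ x j = c']) ->
    upper_edge (-%R \o x) (-%R \o y) (I `\` I') (J `\` J') (- c').
  move=> J'c nearc copies.
  have restrict s e : - c' <= s -> dominated (-%R \o x) (-%R \o y) I J s e ->
      dominated (-%R \o x) (-%R \o y) (I `\` I') (J `\` J') s e.
    move=> cs dom; apply: dominated_rows (_ : dominated _ _ I _ _ _); first by move=> i [].
    apply: dominated_restrict dom => j Jj nj /=; apply: le_trans cs; rewrite lerN2.
    by apply: J'c; apply: contrapT => nJ'; apply: nj.
  split=> [s /F1|d /nearc|s cs|].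
  - by apply: sub_finite_set => j [[]].
  - by apply: sub_infinite_set => j [Jj] /=; rewrite -opprD normrN.
  - exact/restrict/F3.
  - case: F4 => [copies'|[e [t [e0 ct dom]]]]; [left|right].
      have : infinite_set [set j | J j /\ x j = c'].
        by apply: sub_infinite_set copies' => j [Jj /= /oppr_inj].
      by move/copies; apply: sub_infinite_set => j [Jj /= ->].
    exists e, t; split=> // s st; apply: restrict; last exact: dom.
    by case/andP: st.
have [c'c|ccle] := ltP c' c.
  have d0 : 0 < (c - c') / 2 by lra.
  have [I' [J' U]] := upper_part_exists Ec d0; apply: (remain _ _ _ U).
  have [_ _ cost _ _] := U.
  have J'c j : J' j -> (c + c') / 2 <= x j.
    move=> J'j; have [xc|cx] := leP (x j) c; last by lra.
    have := cost [:: j] isT; rewrite big_seq1 => costj.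
    have /costj : forall k, k \in [:: j] -> J' k /\ x k <= c by move=> k; rewrite inE => /eqP ->.
    by lra.
  have away j : J j -> x j < (c + c') / 2 -> (J `\` J') j.
    by move=> Jj xj; split=> // /J'c; rewrite leNgt xj.
  apply: keep => [j /J'c|d d1|]; first by lra.
    have d2 : 0 < Num.min d ((c - c') / 2) by rewrite lt_min d1.
    apply: sub_infinite_set (F2 _ d2) => j [Jj] /=; rewrite -opprD normrN lt_min.
    move=> /andP[xd]; rewrite ltr_norml => /andP[_ xc]; split=> //.
    by apply: away => //; lra.
  apply: sub_infinite_set => j [Jj xj]; split=> //; apply: away => //; lra.
have {ccle cc} cE : c' = c by apply/eqP; rewrite eq_le cc ccle.
rewrite cE in Ec' F1 F2 F3 F4 remain keep *.
have [copies|nocopies] := pselect (infinite_set [set j | J j /\ x j = c]).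
  have [I' [J' U]] := upper_part_exists Ec ltr01; apply: (remain _ _ _ U).
  have [_ _ _ cp near] := U; have [J'c copies'] := cp copies.
  exact: keep.
case: F4 => [copies'|[e [t [e0 ct dom]]]].
  by case: nocopies; apply: sub_infinite_set copies' => j [Jj /= /oppr_inj].
have d0 : 0 < Num.min (e / 2) (t + c) by rewrite lt_min divr_gt0//; lra.
have [I' [J' U]] := upper_part_exists Ec d0; apply: (remain _ _ _ U).
have [_ _ cost _ near] := U.
have slack s : - c <= s <= t ->
    dominated (-%R \o x) (-%R \o y) (I `\` I') (J `\` J') s (e / 2).
  move=> st; apply: dominated_rows (_ : dominated _ _ I _ _ _); first by move=> i [].
  apply: (@dominated_weaken _ _ _ _ _ (e - e / 2)); first by lra.
  apply: dominated_sparse (dom _ st) => F Fu FJ.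
  pose F' := [seq j <- F | x j <= c].
  apply: (@le_trans _ _ (\sum_(j <- F') (c - x j))).
    rewrite big_filter [leRHS]big_mkcond; rewrite big_seq [leRHS]big_seq.
    case/andP: st => cs _; apply: ler_sum => j _ /=.
    by case: (leP (x j) c) => cx; lra.
  apply: (@le_trans _ _ (Num.min (e / 2) (t + c))); last by rewrite ge_min lexx.
  apply: cost; first exact: filter_uniq.
  move=> j; rewrite mem_filter => /andP[xc /FJ[Jj nj]]; split=> //.
  by apply: contrapT => nJ'; apply: nj.
split=> [s /F1|d /near|s cs|].
- by apply: sub_finite_set => j [[]].
- by apply: sub_infinite_set => j [Jj] /=; rewrite -opprD normrN.
- have [st|ts] := leP s t.
    by apply: dominated_weaken (slack s _); [lra|rewrite cs].
  apply: dominated_rows (_ : dominated _ _ I _ _ _); first by move=> i [].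
  apply: dominated_restrict (F3 s cs) => j Jj nj /=.
  have J'j : J' j by apply: contrapT => nJ'; apply: nj.
  have [xc|cx] := leP (x j) c; last by lra.
  have := cost [:: j] isT; rewrite big_seq1 le_min => costj.
  have /costj/andP[_] : forall k, k \in [:: j] -> J' k /\ x k <= c.
    by move=> k; rewrite inE => /eqP ->.
  by lra.
- by right; exists (e / 2), t; split=> //; lra.
Qed.

End Blocks.

(** * Stochastic matrices and the cuts that they respect *)

Section StochasticRows.
Variable R : realType.
Implicit Types (w : nat -> nat -> R) (x y : nat -> R) (I J : set nat) (F G : seq nat)
  (D : set R) (s e c d t r : R).

(** This is [y = w x] for a matrix [w] with nonnegative entries, row sums one and
    column sums at most one.  With all series in [R], the condition is invariant
    under a change of the signs of [x] and [y]. *)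
Definition acts w x y :=
  [/\ forall i j, 0 <= w i j, forall i, series (w i) @ \oo --> (1 : R),
      forall j G, uniq G -> \sum_(i <- G) w i j <= 1
    & forall i, series (fun j => w i j * x j) @ \oo --> y i].

Lemma actsN w x y : acts w x y -> acts w (-%R \o x) (-%R \o y).
Proof.
move=> [w0 w1 wc wx]; split=> // i.
rewrite (_ : series _ = - series (fun j => w i j * x j)); first exact: cvgN.
by apply/funext => n; rewrite /series /= -[RHS]/(- _) -sumrN; apply: eq_bigr => j _; rewrite mulrN.
Qed.

Lemma acts_sum w x y s G : acts w x y ->
  (fun n => \sum_(0 <= j < n) (\sum_(i <- G) w i j) * (x j - s)) @ \oo -->
  \sum_(i <- G) (y i - s).
Proof.
move=> [_ w1 _ wx].
have row i : (fun n => \sum_(0 <= j < n) w i j * (x j - s)) @ \oo --> y i - s.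
  rewrite -[X in _ --> _ - X]mul1r.
  rewrite (_ : (fun _ => _) = series (fun j => w i j * x j) \- (fun n => series (w i) n * s)).
    by apply: cvgB; [exact: wx|apply: cvgMl; exact: w1].
  apply/funext => n; rewrite /series/= mulr_suml -sumrB.
  by apply: eq_bigr => j _; rewrite mulrBr.
rewrite (_ : (fun _ => _) = fun n => \sum_(i <- G) \sum_(0 <= j < n) w i j * (x j - s)).
  by apply: cvg_big => [|i _]; [exact: add_continuous|exact: row].
apply/funext => n; rewrite exchange_big/=; apply: eq_bigr => j _.
by rewrite mulr_suml.
Qed.

(** Summing the estimates for the columns over a long initial segment and passing
    to the limit; the column [k] carries the gain [e]. *)
Lemma acts_excess w x y G s (K : pred nat) k e B : acts w x y -> uniq G ->
  (forall j, (\sum_(i <- G) w i j) * (x j - s) <=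
     (if K j then x j - s else 0) - (if j == k then e else 0)) ->
  (forall F, uniq F -> (forall j, j \in F -> K j) -> \sum_(j <- F) (x j - s) <= B) ->
  \sum_(i <- G) (y i - s) + e <= B.
Proof.
move=> wxy Gu col FB; rewrite -lerBrDr.
have cv := @acts_sum w x y s G wxy.
rewrite -(cvg_lim _ cv)//; apply: limr_le; first by apply/cvg_ex; eexists; exact: cv.
exists k.+1 => // n /= kn; rewrite lerBrDr.
apply: (@le_trans _ _ (\sum_(j <- [seq j <- index_iota 0 n | K j]) (x j - s))); last first.
  apply: FB; first by rewrite filter_uniq// iota_uniq.
  by move=> j; rewrite mem_filter => /andP[].
rewrite big_filter [leRHS]big_mkcond/= -lerBrDr.
have -> : e = \sum_(0 <= j < n) (if j == k then e else 0).
  rewrite (bigD1_seq k)/=; first by rewrite eqxx big1 ?addr0// => j /negPf ->.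
    by rewrite mem_index_iota.
  exact: iota_uniq.
by rewrite -sumrB; apply: ler_sum => j _; exact: col.
Qed.

Lemma column_sum01 w x y G j : acts w x y -> uniq G ->
  0 <= \sum_(i <- G) w i j <= 1.
Proof. by move=> [w0 _ wc _] Gu; rewrite wc// andbT; apply: sumr_ge0. Qed.

Lemma column_used w G j : (forall i j, 0 <= w i j) -> 0 < \sum_(i <- G) w i j ->
  exists2 i, i \in G & 0 < w i j.
Proof.
move=> w0 Gj; apply: contrapT => no; move: Gj; rewrite big_seq big1 ?ltxx// => i iG.
by apply/eqP; rewrite eq_le w0 andbT leNgt; apply/negP => wij; apply: no; exists i.
Qed.

(** Jensen's inequality for the convex function max(t - s, 0): only the columns
    with entries above [s] count, and their sums are at most one. *)
Lemma acts_dominated w x y I J s : acts w x y ->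
  (forall i j, I i -> 0 < w i j -> s < x j -> J j) -> dominated x y I J s 0.
Proof.
move=> wxy IJ B FB G Gu GI; have [w0 _ _ _] := wxy.
pose K j := (s < x j) && (0 < \sum_(i <- G) w i j).
apply: (@acts_excess w x y G s K 0%N 0) => // [j|F Fu FK].
  rewrite if_same subr0 /K; have /andP[C0 C1] := column_sum01 j wxy Gu.
  have [sx|xs] := ltP s (x j) => /=; last by rewrite mulr_ge0_le0// subr_le0.
  case: ltP => Cj; first by rewrite ler_piMl// subr_ge0 ltW.
  by rewrite mulr_le0_ge0// subr_ge0 ltW.
apply: FB => // j /FK/andP[sx /(column_used w0)[i iG wij]].
exact: IJ (GI i iG) wij sx.
Qed.

(** At a level that some row crosses, Jensen's inequality is strict. *)
Definition crossed w x c := exists i j j',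
  [/\ 0 < w i j, 0 < w i j', x j < c & c < x j'].

(** If the crossing row is among those summed, it loses because it also uses an
    entry below [c]; if not, the part of the column [j0] that it uses is not
    available to the others.  Both losses stay away from zero on an interval of
    levels that begins at [c]. *)
Lemma acts_slack w x y I J c i1 j1 j0 : acts w x y ->
  (forall s, c <= s -> forall i j, I i -> 0 < w i j -> s < x j -> J j) ->
  0 < w i1 j1 -> 0 < w i1 j0 -> x j1 < c -> c < x j0 -> J j0 ->
  exists e t, [/\ 0 < e, c < t & forall s, c <= s <= t -> dominated x y I J s e].
Proof.
move=> wxy IJ w1 w2 x1 x0 J0; have [w0 _ wc _] := wxy.
pose t := (c + x j0) / 2; have ct : c < t by rewrite /t; lra.
have tx : t < x j0 by rewrite /t; lra.
pose e := Num.min (w i1 j1 * (c - x j1)) (w i1 j0 * (x j0 - t)).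
have e0 : 0 < e by rewrite lt_min !mulr_gt0 ?subr_gt0.
exists e, t; split=> // s /andP[cs st] B FB G Gu GI.
(* The column j0 is counted even when the rows in G do not use it. *)
pose K j := (s < x j) && ((0 < \sum_(i <- G) w i j) || (j == j0)).
have KB F : uniq F -> (forall j, j \in F -> K j) -> \sum_(j <- F) (x j - s) <= B.
  move=> Fu FK; apply: FB => // j /FK/andP[sx /orP[|/eqP ->//]].
  by move=> /(column_used w0)[i iG wij]; exact: (IJ s cs i) (GI i iG) wij sx.
have base j : (\sum_(i <- G) w i j) * (x j - s) <= (if K j then x j - s else 0).
  have /andP[C0 C1] := column_sum01 j wxy Gu; rewrite /K.
  have [sx|xs] := ltP s (x j) => /=; last by rewrite mulr_ge0_le0// subr_le0.
  case: ifP => Cj; first by rewrite ler_piMl// subr_ge0 ltW.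
  move/negbT: Cj; rewrite negb_or -leNgt => /andP[Cj _].
  by rewrite mulr_le0_ge0// subr_ge0 ltW.
have [i1G|i1G] := boolP (i1 \in G).
  apply: (@acts_excess w x y G s K j1 e) => // j.
  case: eqVneq => [->|_]; last by rewrite subr0.
  have -> : K j1 = false by rewrite /K ltNge (le_trans (ltW x1) cs).
  have wC : w i1 j1 <= \sum_(i <- G) w i j1.
    by rewrite (bigD1_seq i1)//= lerDl; apply: sumr_ge0.
  rewrite sub0r -lerN2 opprK -mulrN opprB.
  apply: (@le_trans _ _ (w i1 j1 * (c - x j1))); first by rewrite ge_min lexx.
  apply: ler_pM => //; lra.
apply: (@acts_excess w x y G s K j0 e) => // j.
case: eqVneq => [->|_]; last by rewrite subr0.
have -> : K j0 by rewrite /K eqxx orbT andbT; lra.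
have := wc j0 (i1 :: G); rewrite big_cons/= i1G Gu => /(_ isT) wC.
have : e <= w i1 j0 * (x j0 - t) by rewrite ge_min lexx orbT.
have : w i1 j0 * (x j0 - t) <= w i1 j0 * (x j0 - s) by apply: ler_wpM2l; [exact: ltW|lra].
have : (\sum_(i <- G) w i j0 + w i1 j0) * (x j0 - s) <= x j0 - s.
  by rewrite ler_piMl; lra.
by rewrite mulrDl; lra.
Qed.

(** A mean of numbers at most [c], one of which is smaller, is smaller than [c]. *)
Lemma uncrossed_above w x y c i j : acts w x y -> ~ crossed w x c ->
  c <= y i -> 0 < w i j -> c <= x j.
Proof.
move=> wxy nc cy wij; have [w0 _ _ _] := wxy.
rewrite leNgt; apply/negP => xc.
have wpos : 0 < w i j * (c - x j) by rewrite mulr_gt0// subr_gt0.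
have : \sum_(i <- [:: i]) (y i - c) + w i j * (c - x j) <= 0.
  apply: (@acts_excess w x y [:: i] c pred0 j) => //= [k|F Fu FK]; last first.
    by case: F FK {Fu} => [_|k F /(_ k (mem_head _ _))//]; rewrite big_nil.
  rewrite big_seq1 sub0r; case: eqVneq => [->|_]; first by rewrite -mulrN opprB.
  rewrite oppr0; have := w0 i k; rewrite le_eqVlt => /predU1P[<-|wik]; first by rewrite mul0r.
  rewrite pmulr_rle0// subr_le0 leNgt; apply/negP => ck; apply: nc.
  by exists i, j, k.
by rewrite big_seq1; lra.
Qed.

Lemma crossedN w x c : crossed w (-%R \o x) (- c) <-> crossed w x c.
Proof.
split=> -[i [j [j' [wj wj' xj xj']]]]; exists i, j', j; split=> //=; rewrite ?ltrN2//.
  by move: xj'; rewrite /= ltrN2.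
by move: xj; rewrite /= ltrN2.
Qed.

Lemma uncrossed_below w x y c i j : acts w x y -> ~ crossed w x c ->
  y i <= c -> 0 < w i j -> x j <= c.
Proof.
move=> /actsN wxy nc cy wij; rewrite -lerN2.
by apply: (uncrossed_above (i := i) wxy) => //=; [move/crossedN|rewrite lerN2].
Qed.

(** The rows and columns greater than [c] can be separated from the others when
    no row crosses [c] and the entries above [c] accumulate at [c]: the rows above
    [c] then do not depend on the entries equal to [c]. *)
Definition cut_after w x c := ~ crossed w x c /\
  forall e, 0 < e -> infinite_set [set j | c < x j < c + e].

Definition cut_before w x c := ~ crossed w x c /\
  forall e, 0 < e -> infinite_set [set j | c - e < x j < c].

(** A cut of the first kind belongs to the class below it, a cut of the second
    kind to the class above it. *)
Definition separated w x r r' :=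
  (exists2 c, cut_after w x c & r <= c < r') \/ (exists2 c, cut_before w x c & r < c <= r').

Lemma separated_lt w x r r' : separated w x r r' -> r < r'.
Proof.
by move=> [[c _ /andP[]]|[c _ /andP[]]]; [exact: le_lt_trans|exact: lt_le_trans].
Qed.

Lemma cut_afterN w x c : cut_after w (-%R \o x) (- c) <-> cut_before w x c.
Proof.
split=> -[nc inf]; split=> [/crossedN//|e e0]; apply: sub_infinite_set (inf e e0) => j /=.
  by lra.
by lra.
Qed.

Lemma cut_beforeN w x c : cut_before w (-%R \o x) (- c) <-> cut_after w x c.
Proof.
split=> -[nc inf]; split=> [/crossedN//|e e0]; apply: sub_infinite_set (inf e e0) => j /=.
  by lra.
by lra.
Qed.

Lemma separatedN w x r r' : separated w (-%R \o x) (- r') (- r) <-> separated w x r r'.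
Proof.
split=> -[[c cc cr]|[c cc cr]].
- by right; exists (- c); [apply/cut_afterN; rewrite opprK|lra].
- by left; exists (- c); [apply/cut_beforeN; rewrite opprK|lra].
- by right; exists (- c); [apply/cut_beforeN|lra].
- by left; exists (- c); [apply/cut_afterN|lra].
Qed.

(** One of the intervals into which the cuts divide the line. *)
Definition is_class w x D :=
  (forall d d', D d -> D d' -> ~ separated w x d d') /\
  (forall d r, D d -> ~ D r -> separated w x r d \/ separated w x d r).

Lemma is_classN w x D : is_class w x D -> is_class w (-%R \o x) [set r | D (- r)].
Proof.
move=> [D1 D2]; split=> [d d' /= Dd Dd'|d r /= Dd nDr].
  by rewrite -(opprK d) -(opprK d') => /separatedN; exact: D1.
rewrite -(opprK d) -(opprK r); case: (D2 _ _ Dd nDr) => sep; [right|left].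
  exact/separatedN.
exact/separatedN.
Qed.

Section Class.
Variables (w : nat -> nat -> R) (x y : nat -> R) (D : set R).
Hypotheses (wxy : acts w x y) (classD : is_class w x D).
Let I : set nat := [set i | D (y i)].
Let J : set nat := [set j | D (x j)].

(** A column used by a row of the class but outside of it lies at the end of the
    class.  There the class accumulates, so that its rows can do without this
    column. *)
Lemma class_boundary_above i j : I i -> 0 < w i j -> separated w x (y i) (x j) ->
  cut_before w x (x j) /\ forall r, y i < r < x j -> D r.
Proof.
move=> Ii wij sep; have [D1 D2] := classD.
have notbelow c : cut_after w x c -> y i <= c -> x j <= c.
  by move=> [nc _] yc; exact: (uncrossed_below wxy nc yc).
have notabove c : cut_before w x c -> y i <= c -> x j <= c.
  by move=> [nc _] yc; exact: (uncrossed_below wxy nc yc).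
have cutx : cut_before w x (x j).
  case: sep => [[c cb /andP[yc cx]]|[c ca /andP[yc cx]]].
    by have := notbelow c cb yc; rewrite leNgt cx.
  by have -> : x j = c by apply/eqP; rewrite eq_le cx (notabove c ca (ltW yc)).
split=> // r /andP[yr rx]; apply: contrapT => nDr.
case: (D2 _ _ Ii nDr) => [/separated_lt|]; first by rewrite ltNge ltW.
case=> [[c cb /andP[yc cr]]|[c ca /andP[yc cr]]].
  by have := notbelow c cb yc; rewrite leNgt (lt_trans cr rx).
by have := notabove c ca (ltW yc); rewrite leNgt (le_lt_trans cr rx).
Qed.

Lemma class_infinite_above i j : I i -> 0 < w i j -> separated w x (y i) (x j) ->
  forall d, D d -> d < x j /\ infinite_set [set k | J k /\ d <= x k].
Proof.
move=> Ii wij sep d Dd; have [D1 _] := classD.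
have [cutx between] := class_boundary_above Ii wij sep.
have yx := separated_lt sep.
have dx : d < x j.
  rewrite ltNge; apply/negP => xd; apply: (D1 _ _ Ii Dd); right.
  by exists (x j) => //; rewrite yx.
split=> //; pose e := Num.min (x j - y i) (x j - d).
have e0 : 0 < e by rewrite lt_min !subr_gt0 yx.
apply: sub_infinite_set (cutx.2 e e0) => k /= /andP[ek kx].
have ey : e <= x j - y i by rewrite ge_min lexx.
have ed : e <= x j - d by rewrite ge_min lexx orbT.
by split; [apply: between; rewrite kx andbT; lra|lra].
Qed.

Lemma class_unused_above i j : I i -> 0 < w i j -> ~ D (x j) ->
  (exists2 k, I k & finite_set [set j | J j /\ y k <= x j]) ->
  forall d, D d -> x j < d.
Proof.
move=> Ii wij nDx [k Ik fin] d Dd; have [D1 D2] := classD.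
case: (D2 _ _ Ii nDx) => sep; last first.
  by have [_ /(_ fin)] := class_infinite_above Ii wij sep Ik.
rewrite ltNge; apply/negP => dx; apply: (D1 _ _ Dd Ii).
case: sep => [[c cb /andP[xc cy]]|[c ca /andP[xc cy]]]; [left|right].
  by exists c => //; rewrite (le_trans dx xc).
by exists c => //; rewrite (le_lt_trans dx xc).
Qed.

(** Let [c] be the upper limit of the entries in the class.  If some row reaches
    it and [c] is finite, then [c] has infinitely many copies, or it is crossed
    and there is slack, or it is a cut.  In the last case the entries accumulate
    at [c] from above, and the whole class is a decreasing list above [c]; from
    below they cannot, because the class would then end before [c]. *)
Lemma class_upper_status : infinite_set J ->
  [\/ forall i, I i -> infinite_set [set j | J j /\ y i <= x j],
      realizable x y I J | exists c, upper_edge x y I J c].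
Proof.
move=> Ji; have [D1 D2] := classD.
have [up|] := pselect (forall i, I i -> infinite_set [set j | J j /\ y i <= x j]).
  exact: Or31.
move=> /existsNP[k /not_implyP[Ik /contrapT fink]].
have unused i j : I i -> 0 < w i j -> ~ D (x j) -> forall d, D d -> x j < d.
  by move=> Ii wij nDx; apply: (class_unused_above Ii wij nDx); exists k.
have domD s : (exists2 d, D d & d <= s) -> dominated x y I J s 0.
  move=> [d Dd ds]; apply: (acts_dominated wxy) => i j Ii wij sx; apply: contrapT => nDx.
  by have := unused i j Ii wij nDx d Dd; rewrite ltNge (le_trans ds (ltW sx)).
have descend : (forall j, J j -> finite_set [set k | J k /\ x j <= x k]) ->
    (forall i, I i -> exists2 j, J j & x j <= y i) -> realizable x y I J.
  move=> fin low; apply: realizable_descending => // j Jj.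
  by apply: domD; exists (x j).
pose S := [set s : R | finite_set [set j | J j /\ s <= x j]].
have S0 : S (y k) by [].
have Sup s s' : S s -> s <= s' -> S s'.
  by move=> Ss ss; apply: sub_finite_set Ss => j [Jj sj]; split=> //; exact: le_trans sj.
have [Slb|nSlb] := pselect (has_lbound S); last first.
  have Sall s : S s.
    apply: contrapT => nSs; apply: nSlb; exists s => s' Ss'.
    by rewrite leNgt; apply/negP => ss'; apply: nSs; exact: Sup Ss' (ltW ss').
  apply: Or32; apply: descend => [j _|i _]; first exact: Sall.
  have [j [Jj nj]] := infinite_setN0 (infinite_setD Ji (Sall (y i))).
  by exists j => //; rewrite leNgt; apply/negP => /ltW yx; apply: nj.
have Sinf : has_inf S by split=> //; exists (y k).
pose c := inf S.
have ck : c <= y k by exact: inf_lbound.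
have E1 s : c < s -> finite_set [set j | J j /\ s <= x j].
  by move=> /(inf_lt (ex_intro _ _ S0))[s' Ss' /ltW]; exact: Sup.
have E1' s : s < c -> infinite_set [set j | J j /\ s <= x j].
  by move=> sc Ss; have := inf_lbound Slb Ss; rewrite leNgt sc.
have E2 d : 0 < d -> infinite_set [set j | J j /\ `|x j - c| < d].
  move=> d0; have c1 : c - d / 2 < c by lra.
  have c2 : c < c + d by lra.
  apply: sub_infinite_set (infinite_setD (E1' _ c1) (E1 _ c2)) => j [[Jj cj] nj].
  split=> //; rewrite ltr_norml; apply/andP; split; first by lra.
  by rewrite ltrBlDl ltNge; apply/negP => cdj; apply: nj.
have usedJ s : c <= s -> forall i j, I i -> 0 < w i j -> s < x j -> J j.
  move=> cs i j Ii wij sx; apply: contrapT => nDx.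
  have xc : 0 < x j - c by lra.
  have [l [Jl]] := infinite_setN0 (E2 _ xc).
  by have := unused i j Ii wij nDx _ Jl; rewrite ltr_norml; lra.
have E3 s : c <= s -> dominated x y I J s 0.
  by move=> cs; apply: (acts_dominated wxy) => i j Ii; exact: usedJ.
have [copies|nocopies] := pselect (infinite_set [set j | J j /\ x j = c]).
  by apply: Or33; exists c; split=> //; left.
have [[i1 [j1 [j0 [w1 w0 x1 x0]]]]|ncr] := pselect (crossed w x c).
  have m0 : 0 < Num.min (c - x j1) (x j0 - c) by rewrite lt_min !subr_gt0 x1.
  have [l [Jl]] := infinite_setN0 (E2 _ m0).
  rewrite lt_min => /andP[]; rewrite !ltr_norml => /andP[l1 l2] /andP[l3 l4].
  have xl0 : x l < x j0 by lra.
  have xl1 : x j1 < x l by lra.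
  have Ii1 : I i1.
    apply: contrapT => nI; case: (D2 _ _ Jl nI) => -[[e [nce _] /andP[le er]]|[e [nce _] /andP[le er]]].
    - have := uncrossed_below wxy nce le w0; lra.
    - have := uncrossed_below wxy nce (ltW le) w0; lra.
    - have := uncrossed_above wxy nce (ltW er) w1; lra.
    - have := uncrossed_above wxy nce er w1; lra.
  have Jj0 : J j0.
    apply: contrapT => nJ; have := unused i1 j0 Ii1 w0 nJ _ Jl; lra.
  apply: Or33; exists c; split=> //; right.
  by have := acts_slack wxy usedJ w1 w0 x1 x0 Jj0.
have [above|] := pselect (forall e, 0 < e -> infinite_set [set j | J j /\ c < x j < c + e]).
  have cutc : cut_after w x c.
    by split=> // e /above; apply: sub_infinite_set => j [].
  have [j0 [Jj0 /andP[cj0 _]]] := infinite_setN0 (above 1 ltr01).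
  have Dc d : D d -> c < d.
    move=> Dd; rewrite ltNge; apply/negP => dc; apply: (D1 _ _ Dd Jj0); left.
    by exists c => //; rewrite dc.
  apply: Or32; apply: descend => [j /Dc|i /Dc ci]; first exact: E1.
  have e0 : 0 < y i - c by lra.
  have [j [Jj jc]] := infinite_setN0 (above _ e0).
  by exists j => //; lra.
move=> /existsNP[e0 /not_implyP[e0pos /contrapT fine0]].
have belowJ e : 0 < e -> infinite_set [set j | J j /\ c - e < x j < c].
  move=> epos; have m0 : 0 < Num.min e e0 by rewrite lt_min epos.
  have finc : finite_set [set j | J j /\ x j = c] by exact: contrapT.
  apply: sub_infinite_set (infinite_setD (infinite_setD (E2 _ m0) fine0) finc).
  move=> j [[[Jj]]] + na nc; rewrite lt_min => /andP[]; rewrite !ltr_norml => /andP[l1 l2] /andP[l3 l4].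
  have xc : x j != c by apply/eqP => xc; apply: nc.
  have xc' : x j <= c by rewrite leNgt; apply/negP => cx; apply: na; split=> //; lra.
  have xc2 : x j < c by rewrite lt_neqAle xc.
  by split=> //; rewrite xc2 andbT; lra.
have cutc : cut_before w x c.
  by split=> // e /belowJ; apply: sub_infinite_set => j [].
have [j [Jj /andP[_ jc]]] := infinite_setN0 (belowJ 1 ltr01).
by case: (D1 _ _ Jj Ik); right; exists c => //; rewrite jc.
Qed.

End Class.

Lemma acts_realizable_class w x y D : acts w x y -> is_class w x D ->
  realizable x y [set i | D (y i)] [set j | D (x j)].
Proof.
move=> wxy classD.
have wxyN := actsN wxy; have classDN := is_classN classD.
have IN : [set i | [set r | D (- r)] ((-%R \o y) i)] = [set i | D (y i)].
  by apply/seteqP; split=> i /=; rewrite opprK.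
have JN : [set j | [set r | D (- r)] ((-%R \o x) j)] = [set j | D (x j)].
  by apply/seteqP; split=> j /=; rewrite opprK.
have NN (z : nat -> R) : -%R \o (-%R \o z) = z by apply/funext => n /=; rewrite opprK.
have [Jf|Ji] := pselect (finite_set [set j | D (x j)]).
  have used i j : D (y i) -> 0 < w i j -> D (x j).
    move=> Di wij; apply: contrapT => nDx; case: (classD.2 _ _ Di nDx) => sep.
      have sepN : separated w (-%R \o x) ((-%R \o y) i) ((-%R \o x) j) by apply/separatedN.
      have DiN : [set r | D (- r)] ((-%R \o y) i) by rewrite /= opprK.
      have [_] := class_infinite_above wxyN classDN DiN wij sepN DiN.
      by apply; apply: sub_finite_set Jf => k [/=]; rewrite opprK.
    have [_] := class_infinite_above wxy classD Di wij sep Di.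
    by apply; apply: sub_finite_set Jf => k [].
  apply: realizable_finite => // s.
    by apply: (acts_dominated wxy) => i j Di wij _; exact: used wij.
  by apply: (acts_dominated wxyN) => i j Di wij _; exact: used wij.
have JNi : infinite_set [set j | [set r | D (- r)] ((-%R \o x) j)] by rewrite JN.
have lowN (P : (forall i, D (y i) -> infinite_set [set j | D (x j) /\ (-%R \o y) i <= (-%R \o x) j])) :
    forall i, D (y i) -> infinite_set [set j | D (x j) /\ x j <= y i].
  by move=> i /P; apply: sub_infinite_set => j [Dj] /=; rewrite lerN2.
have [] := class_upper_status wxyN classDN JNi; rewrite IN JN => lower.
- have [upper|//|[c Ec]] := class_upper_status wxy classD Ji.
    apply: realizable_mid => // i Di; apply: (@lowN lower i Di).
  by apply: realizable_edge_lower Ec _; exact: lowN.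
- exact: realizableN.
have [c' Ec'] := lower.
have [upper|//|[c Ec]] := class_upper_status wxy classD Ji.
  apply/realizableN/(realizable_edge_lower Ec') => i /upper.
  by apply: sub_infinite_set => j [Dj yx]; split=> //=; rewrite lerN2.
by apply: (realizable_edges (c' := - c') Ec); rewrite opprK.
Qed.

Lemma acts_realizable w x y : acts w x y -> realizable x y setT setT.
Proof.
move=> wxy; pose D r r' := ~ separated w x r r' /\ ~ separated w x r' r.
have sepT r r' r'' : separated w x r r'' -> separated w x r r' \/ separated w x r' r''.
  move=> [[c cc /andP[rc cr]]|[c cc /andP[rc cr]]].
    have [r'c|cr'] := leP r' c; [right|left]; left; exists c => //.
      by rewrite r'c.
    by rewrite rc.
  have [cr'|r'c] := leP c r'; [left|right]; right; exists c => //.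
    by rewrite rc.
  by rewrite r'c.
have Dsym r r' : D r r' -> D r' r by case.
have Dtrans r r' r'' : D r r' -> D r' r'' -> D r r''.
  by move=> [n1 n2] [n3 n4]; split=> /(sepT _ r')[].
apply: (@realizable_classes _ x y D) => [r|r r' rr'|i].
- by split=> /separated_lt; rewrite ltxx.
- apply/seteqP; split=> r''; first exact: Dtrans.
  by apply: Dtrans; exact: Dsym.
apply: (acts_realizable_class wxy); split=> [d d' Dd Dd'|d r Dd nDr].
  by have [] := Dtrans _ _ _ (Dsym _ _ Dd) Dd'.
apply: contrapT => /not_orP[n1 n2]; apply: nDr; apply: Dtrans Dd _.
by split.
Qed.

End StochasticRows.

(** * Partial sums and copies of limit points *)

Section Majorization.
Variable R : realType.
Implicit Types (x y z : nat -> R) (F G : seq nat) (s e c d t r B : R).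

Definition majorized x y := forall s, dominated x y setT setT s 0.

Lemma Rplus_ge x m F : uniq F -> size F = m -> ((\sum_(j <- F) x j)%:E <= Rplus x m)%E.
Proof.
move=> Fu Fm; subst m; apply: ereal_sup_ubound; exists (fun n => nth 0%N F n).
  by move=> a b /eqP; rewrite nth_uniq// => /eqP/val_inj.
by rewrite (big_nth 0%N) big_mkord.
Qed.

Lemma Rplus_le x m b : (forall F, uniq F -> size F = m -> ((\sum_(j <- F) x j)%:E <= b)%E) ->
  (Rplus x m <= b)%E.
Proof.
move=> Fb; apply: ge_ereal_sup => _ [j /= ji <-].
have := Fb [seq j n | n <- enum 'I_m].
rewrite big_map big_enum size_map size_enum_ord; apply=> //.
by rewrite map_inj_uniq// enum_uniq.
Qed.

Lemma Rminus_opp x m : Rminus x m = (- Rplus (-%R \o x) m)%E.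
Proof.
rewrite /Rminus /Rplus /ereal_inf; congr (- ereal_sup _)%E.
apply/seteqP; split=> [e [_ [j ji <-] <-]|e [j ji <-]].
  by exists j => //=; rewrite sumrN.
exists (\sum_(n < m) x (j n))%:E; first by exists j.
by rewrite /= sumrN.
Qed.

Definition below_Rplus x y := forall m, (0 < m)%N -> forall i : 'I_m -> nat, injective i ->
  ((\sum_(n < m) y (i n))%:E <= Rplus x m)%E.

Lemma Q_setE x y : Q_set x y <-> below_Rplus x y /\ below_Rplus (-%R \o x) (-%R \o y).
Proof.
split=> [Qy|[up low] m m0 i ii].
  split=> m m0 i ii; have /andP[] := Qy m m0 i ii; first by [].
  by rewrite Rminus_opp leeNl -EFinN sumrN.
by rewrite up// andbT Rminus_opp leeNl -EFinN -sumrN; exact: low.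
Qed.

(** Let [l] be the m-th largest entry, as a supremum: less than m entries exceed
    [l], and for each e > 0 there are m entries from [l - e] on.  Hence the sums
    of excesses over [l] are at most [Rplus x m - m l], and dominance at the level
    [l] is the required bound. *)
Lemma majorized_below_Rplus x y : majorized x y -> below_Rplus x y.
Proof.
move=> dom m m0 i ii.
have [->|Rfin] := eqVneq (Rplus x m) +oo%E; first by rewrite leey.
have iota_ge : ((\sum_(j <- iota 0 m) x j)%:E <= Rplus x m)%E.
  by apply: Rplus_ge; [exact: iota_uniq|rewrite size_iota].
have [r Rr] : exists r, Rplus x m = r%:E.
  by case: (Rplus x m) Rfin iota_ge => [r _ _|//|//]; exists r.
pose S := [set s : R | exists F, [/\ uniq F, size F = m & forall j, j \in F -> s <= x j]].
have S0 : S (\big[Num.min/x 0%N]_(j <- iota 0 m) x j).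
  exists (iota 0 m); rewrite iota_uniq size_iota; split=> // j jm.
  exact: ge_bigmin_seq.
have Sle s : S s -> s <= r / m%:R.
  move=> [F [Fu Fm Fs]]; rewrite ler_pdivlMr ?ltr0n// -lee_fin -Rr.
  apply: le_trans (Rplus_ge x Fu Fm); rewrite lee_fin mulr_natr -Fm.
  rewrite -[leLHS]addr0 -iter_addr -count_predT -big_const_seq big_seq [leRHS]big_seq.
  by apply: ler_sum => j; exact: Fs.
have Sub : has_sup S by split; [exists (\big[Num.min/x 0%N]_(j <- iota 0 m) x j)|exists (r / m%:R)].
pose l := sup S.
have few F : uniq F -> (forall j, j \in F -> l < x j) -> (size F < m)%N.
  move=> Fu Fl; rewrite ltnNge; apply/negP => mF.
  (* If m entries exceeded l, the least of them would be a larger element of S. *)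
  pose s := \big[Num.min/(l + 1)]_(j <- F) x j.
  have ls : l < s.
    by rewrite /s big_seq; apply: lt_bigmin => [|j]; [rewrite ltrDl|exact: Fl].
  have : S s.
    exists (take m F); rewrite take_uniq// size_takel//; split=> // j /mem_take jF.
    exact: ge_bigmin_seq.
  by move=> /(sup_upper_bound Sub); rewrite leNgt ls.
have many e : 0 < e -> exists F, [/\ uniq F, size F = m & forall j, j \in F -> l - e <= x j].
  move=> e0; have [s [F [Fu Fm Fs]] ls] := sup_adherent e0 Sub.
  by exists F; split=> // j /Fs; exact: le_trans (ltW ls).
have bound F : uniq F -> (forall j, j \in F -> setT j) -> \sum_(j <- F) (x j - l) <= r - m%:R * l.
  move=> Fu _; pose F' := [seq j <- F | l < x j].
  have F'u : uniq F' by rewrite filter_uniq.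
  have F'm : (size F' < m)%N by apply: few => // j; rewrite mem_filter => /andP[].
  apply: (@le_trans _ _ (\sum_(j <- F') (x j - l))).
    apply: sum_excess_le => // j; last by rewrite mem_filter => /andP[/ltW].
    by move=> jF; rewrite mem_filter jF andbT leNgt.
  apply/ler_addgt0Pr => e e0; have em : 0 < e / m%:R by rewrite divr_gt0// ltr0n.
  have [T [Tu Tm Tl]] := many _ em.
  pose T' := take (m - size F') [seq j <- T | j \notin F'].
  have T'F : size T' = (m - size F')%N.
    rewrite size_takel// leq_subLR -{1}Tm -(count_predC (mem F') T) size_filter leq_add2r.
    rewrite -size_filter; apply: uniq_leq_size; first exact: filter_uniq.
    by move=> j; rewrite mem_filter => /andP[].
  have T'T j : j \in T' -> j \in T /\ j \notin F'.
    by move=> /mem_take; rewrite mem_filter => /andP[].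
  have := @Rplus_ge x m (F' ++ T'); rewrite cat_uniq F'u size_cat T'F subnKC ?(ltnW F'm)//.
  rewrite take_uniq ?filter_uniq// andbT => /(_ _ erefl); rewrite Rr lee_fin big_cat/= => FT.
  have {FT} : \sum_(j <- F') x j + \sum_(j <- T') x j <= r.
    by apply: FT; apply/hasPn => j /T'T[].
  have : \sum_(j <- T') (l - e / m%:R) <= \sum_(j <- T') x j.
    by rewrite big_seq [leRHS]big_seq; apply: ler_sum => j /T'T[/Tl].
  rewrite big_const_seq count_predT iter_addr addr0 T'F -[X in X <= _]mulr_natl mulrBr sum_shift.
  have : (m - size F')%:R * (e / m%:R) <= e.
    rewrite mulrCA; apply: ler_piMr; first exact: ltW.
    by rewrite ler_pdivrMr ?ltr0n// mul1r ler_nat leq_subr.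
  by rewrite natrB ?(ltnW F'm)// !mulrBl; lra.
have iu : uniq [seq i n | n <- enum 'I_m] by rewrite map_inj_uniq// enum_uniq.
have := dom l _ bound _ iu (fun _ _ => I).
rewrite addr0 sum_shift size_map size_enum_ord big_map big_enum/= Rr lee_fin; lra.
Qed.

Lemma below_Rplus_majorized x y : below_Rplus x y -> majorized x y.
Proof.
move=> Qy s B FB G Gu _; rewrite addr0.
case Gm : (size G) => [|m].
  by have := FB [::] isT (fun _ _ => I); rewrite (size0nil Gm) !big_nil.
rewrite sum_shift lerBlDr -lee_fin (big_nth 0%N) big_mkord.
have ii : injective (fun n : 'I_(size G) => nth 0%N G n).
  by move=> a b /eqP; rewrite nth_uniq// => /eqP/val_inj.
apply: le_trans (Qy _ _ _ ii) _; first by rewrite Gm.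
apply: Rplus_le => F Fu Fm; rewrite lee_fin -Fm -lerBlDr -sum_shift.
exact: FB.
Qed.

Lemma Q_set_majorized x y :
  Q_set x y <-> majorized x y /\ majorized (-%R \o x) (-%R \o y).
Proof.
rewrite Q_setE; split=> -[up low]; split.
- exact: below_Rplus_majorized.
- exact: below_Rplus_majorized.
- exact: majorized_below_Rplus.
- exact: majorized_below_Rplus.
Qed.

Lemma finite_above_xsup x s : (xsup x < s%:E)%E -> finite_set [set j | s <= x j].
Proof.
rewrite /xsup limn_esup_lim (cvg_lim _ (@cvg_esups_inf R (EFin \o x)))//.
move=> /ereal_inf_lt[_ [n _ <-]] ns.
apply: (@sub_finite_set _ _ `I_n); last exact: finite_II.
move=> j /= sj; rewrite ltnNge; apply/negP => nj.
have : ((x j)%:E <= esups (EFin \o x) n)%E by apply: ereal_sup_ubound; exists j.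
by move=> /le_lt_trans/(_ ns); rewrite lte_fin ltNge sj.
Qed.

Lemma infinite_below_xsup x s : (s%:E < xsup x)%E -> infinite_set [set j | s <= x j].
Proof.
rewrite /xsup limn_esup_lim (cvg_lim _ (@cvg_esups_inf R (EFin \o x)))// => sx.
apply: infinite_set_unbounded => n.
have : (s%:E < esups (EFin \o x) n)%E.
  by apply: lt_le_trans sx _; apply: ereal_inf_lbound; exists n.
move=> /ereal_sup_gt[_ [j /= nj <-]]; rewrite lte_fin => /ltW sj.
by exists j.
Qed.

Lemma xsupN x : xsup (-%R \o x) = (- xinf x)%E.
Proof.
by rewrite /xsup /xinf -limn_esupN; congr limn_esup.
Qed.

Lemma xinfN x : xinf (-%R \o x) = (- xsup x)%E.
Proof.
by rewrite /xsup /xinf -limn_einfN; congr limn_einf.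
Qed.

Lemma xinf_le_xsup x : (xinf x <= xsup x)%E.
Proof. exact: limn_einf_sup. Qed.

(** The extended sequence up to the order of its entries, in a form that is
    invariant under a change of signs. *)
Definition limit_copies_added x z :=
  [/\ exists2 f : nat -> nat, injective f & (forall n, z (f n) = x n) /\
        (forall k, [\/ exists n, k = f n,
           xinf x \is a fin_num /\ z k = fine (xinf x)
         | xsup x \is a fin_num /\ z k = fine (xsup x)]),
      xinf x \is a fin_num -> infinite_set [set k | z k = fine (xinf x)]
    & xsup x \is a fin_num -> infinite_set [set k | z k = fine (xsup x)]].

Lemma is_hat_hatted x z : is_hat x z -> limit_copies_added x z.
Proof.
move=> [r [rfun rinj rsurj] rz].
have inj (t t' : nat + nat + nat) : hat_index x t -> hat_index x t' -> r t = r t' -> t = t'.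
  by move=> ht ht'; apply: rinj; rewrite inE.
split.
- exists (fun n => r (inl (inl n))); first by move=> m n /(inj (inl (inl m)) (inl (inl n)) isT isT)[].
  split=> [n|k]; first by rewrite rz.
  have [[[n|n]|n] ht <-] := rsurj k Logic.I.
  + by constructor 1; exists n.
  + by constructor 2; split=> //; rewrite rz.
  + by constructor 3; split=> //; rewrite rz.
- move=> fin; apply: (@infinite_injection _ (fun n => r (inl (inr n)))).
    by move=> m n /(inj (inl (inr m)) (inl (inr n)) fin fin)[].
  by move=> n /=; rewrite rz.
- move=> fin; apply: (@infinite_injection _ (fun n => r (inr n))).
    by move=> m n /(inj (inr m) (inr n) fin fin)[].
  by move=> n /=; rewrite rz.
Qed.

Lemma limit_copies_addedN x z : limit_copies_added x z -> limit_copies_added (-%R \o x) (-%R \o z).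
Proof.
move=> [[f fi [fz fk]] lo up]; split.
- exists f => //; split=> [n /=|k]; first by rewrite fz.
  rewrite xsupN xinfN (fin_numN (xinf x)) (fin_numN (xsup x)).
  rewrite (fineN (xinf x)) (fineN (xsup x)) /=.
  case: (fk k) => [kf|[fin ->]|[fin ->]].
  + by constructor 1.
  + by constructor 3.
  + by constructor 2.
- rewrite xinfN (fin_numN (xsup x)) (fineN (xsup x)) => /up.
  by apply: sub_infinite_set => k /= ->.
- rewrite xsupN (fin_numN (xinf x)) (fineN (xinf x)) => /lo.
  by apply: sub_infinite_set => k /= ->.
Qed.

Lemma unbounded_excess x s B : (s%:E < xsup x)%E ->
  ~ (forall F, uniq F -> (forall j, j \in F -> setT j) -> \sum_(j <- F) (x j - s) <= B).
Proof.
move=> sx FB.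
have [t st tx] : exists2 t, s < t & (t%:E < xsup x)%E.
  case: (xsup x) sx => [c|_|//]; last by exists (s + 1); rewrite ?ltry//; lra.
  by rewrite lte_fin => sc; exists ((s + c) / 2); rewrite ?lte_fin; lra.
have [g [gi gt]] := injective_choice (fun _ : nat => infinite_below_xsup tx).
(* N entries from t on have a total excess over s greater than B. *)
pose N := (Num.truncn (`|B| / (t - s))).+1.
have d0 : 0 < t - s by rewrite subr_gt0.
have := FB [seq g k | k <- iota 0 N].
rewrite map_inj_uniq ?iota_uniq// => /(_ isT (fun _ _ => I)); apply/negP.
rewrite -ltNge big_map; apply: (@lt_le_trans _ _ (\sum_(k <- iota 0 N) (t - s))); last first.
  by apply: ler_sum => k _; rewrite lerD2r; exact: gt.
rewrite big_const_seq count_predT iter_addr addr0 size_iota -mulr_natl.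
by rewrite -ltr_pdivrMr//; apply: le_lt_trans (truncnS_gt _); rewrite ler_pM2r ?invr_gt0// ler_norm.
Qed.

(** For s below the upper limit of [x] neither side holds.  For the other levels
    the copies of limit points are at most s and contribute nothing positive. *)
Lemma limit_copies_bound x z s B : limit_copies_added x z ->
  (forall F, uniq F -> (forall j, j \in F -> setT j) -> \sum_(j <- F) (x j - s) <= B) <->
  (forall F, uniq F -> (forall j, j \in F -> setT j) -> \sum_(j <- F) (z j - s) <= B).
Proof.
move=> [[f fi [fz fk]] _ _]; split=> FB F Fu _; last first.
  have := FB [seq f n | n <- F]; rewrite map_inj_uniq// => /(_ Fu (fun _ _ => I)).
  by rewrite big_map; under eq_bigr do rewrite fz.
have xs : (xsup x <= s%:E)%E by rewrite leNgt; apply/negP => /unbounded_excess/(_ FB).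
have zs k : s < z k -> range f k.
  move=> sz; case: (fk k) => [[n ->]|[fin zE]|[fin zE]]; first by exists n.
    have : (xinf x <= s%:E)%E := le_trans (xinf_le_xsup x) xs.
    by rewrite -(fineK fin) lee_fin -zE leNgt sz.
  by move: xs; rewrite -(fineK fin) lee_fin -zE leNgt sz.
have [F' FE] : exists F', [seq k <- F | s < z k] = [seq f n | n <- F'].
  elim: F {Fu} => [|k F [F' IH]]; first by exists [::].
  rewrite /=; case: ifP => [/zs[n _ <-]|_]; last by exists F'.
  by exists (n :: F'); rewrite /= IH.
apply: (@le_trans _ _ (\sum_(k <- [seq k <- F | s < z k]) (z k - s))).
  apply: sum_excess_le => //; first exact: filter_uniq.
    by move=> k kF; rewrite mem_filter kF andbT leNgt.
  by move=> k; rewrite mem_filter => /andP[/ltW].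
have : uniq [seq k <- F | s < z k] by exact: filter_uniq.
rewrite FE map_inj_uniq// big_map => F'u.
under eq_bigr do rewrite fz.
exact: (FB F' F'u (fun _ _ => I)).
Qed.

Lemma limit_copies_majorized x z y : limit_copies_added x z -> majorized x y <-> majorized z y.
Proof.
by move=> xz; split=> dom s B FB; apply: dom; apply/(limit_copies_bound s B xz).
Qed.

(** The copies of a finite upper limit of [x] are the columns that can be spared;
    if the upper limit is [-oo], all entries form a decreasing list. *)
Lemma limit_copies_upper_status x z y : limit_copies_added x z -> majorized z y ->
  [\/ forall i, setT i -> infinite_set [set j | setT j /\ y i <= z j],
      realizable z y setT setT | exists c, upper_edge z y setT setT c].
Proof.
move=> [[f fi [fz fk]] lo up] dom.
have above s : (xsup x < s%:E)%E -> finite_set [set j | setT j /\ s <= z j].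
  move=> xs; apply: (sub_finite_set _ (finite_image f (finite_above_xsup xs))).
  move=> k [_ sk]; case: (fk k) => [[n kE]|[fin zE]|[fin zE]].
  - by exists n; rewrite /= ?kE// -fz -kE.
  - have := le_lt_trans (xinf_le_xsup x) xs.
    by rewrite -(fineK fin) lte_fin -zE ltNge sk.
  - by move: xs; rewrite -(fineK fin) lte_fin -zE ltNge sk.
have [supfin|] := boolP (xsup x \is a fin_num).
  have copies := up supfin; move: above copies; rewrite -(fineK supfin).
  move: (fine (xsup x)) => c above copies; constructor 3; exists c.
  have copies' : infinite_set [set j | setT j /\ z j = c].
    by apply: sub_infinite_set copies => j.
  split=> [s cs|d d0|s _|]; [by apply: above; rewrite lte_fin| |exact: dom|by left].
  by apply: sub_infinite_set copies => j /= ->; rewrite subrr normr0.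
rewrite fin_numE negb_and !negbK => /orP[/eqP supE|/eqP supE]; last first.
  constructor 1 => i _; have : ((y i)%:E < xsup x)%E by rewrite supE ltry.
  move=> /infinite_below_xsup xi fin; apply: xi.
  apply: (sub_finite_set _ (finite_preimage (fun m n _ _ => @fi m n) fin)) => n /= yx.
  by rewrite fz.
have {}above s : finite_set [set j | setT j /\ s <= z j] by apply: above; rewrite supE ltNyr.
constructor 2; apply: realizable_descending => //; first exact: infinite_nat.
move=> i _.
have [j [_ nj]] := infinite_setN0 (infinite_setD infinite_nat (above (y i))).
by exists j => //; rewrite leNgt; apply/negP => /ltW yz; apply: nj.
Qed.

Lemma limit_copies_realizable x z y : limit_copies_added x z -> majorized z y ->
  majorized (-%R \o z) (-%R \o y) -> realizable z y setT setT.
Proof.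
move=> xz dom domN.
have [lower|sol|[c' Ec']] := limit_copies_upper_status (limit_copies_addedN xz) domN.
- have {}lower i : setT i -> infinite_set [set j | setT j /\ z j <= y i].
    by move=> /lower; apply: sub_infinite_set => j [_] /=; rewrite lerN2.
  have [upper|//|[c Ec]] := limit_copies_upper_status xz dom; first exact: realizable_mid.
  exact: realizable_edge_lower Ec _.
- exact: realizableN.
have [upper|//|[c Ec]] := limit_copies_upper_status xz dom.
  apply/realizableN/(realizable_edge_lower Ec') => i /upper.
  by apply: sub_infinite_set => j [_ yz]; split=> //=; rewrite lerN2.
by apply: (realizable_edges (c' := - c') Ec); rewrite opprK.
Qed.

End Majorization.

(** * The Hilbert space of square-summable complex sequences *)

Section EllTwo.
Variable R : realType.
Local Notation C := R[i].
Local Notation Re := (@complex.Re R).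
Local Notation Im := (@complex.Im R).
Implicit Types (z : C) (f g h : nat -> C).

Definition rdot (z1 z2 : C) : R := Re z1 * Re z2 + Im z1 * Im z2.

Definition square_summable f :=
  exists B : R, forall n, \sum_(k < n) rdot (f k) (f k) <= B.

Definition ell2_pred : {pred nat -> C} := fun f => `[< square_summable f >].

Lemma rdot_ge0 z : 0 <= rdot z z.
Proof. by rewrite /rdot addr_ge0// -expr2 sqr_ge0. Qed.

Lemma ell2_submod_closed : submod_closed ell2_pred.
Proof.
split.
  apply/asboolP; exists 0 => n; rewrite big1// => k _.
  by rewrite /rdot !mul0r addr0.
move=> [a b] f g /asboolP[B fB] /asboolP[D gD]; apply/asboolP.
exists (2 * (a ^+ 2 + b ^+ 2) * B + 2 * D) => n.
have ab0 : 0 <= 2 * (a ^+ 2 + b ^+ 2) by rewrite mulr_ge0// addr_ge0// sqr_ge0.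
have := lerD (ler_wpM2l ab0 (fB n)) (ler_wpM2l (ler0n R 2) (gD n)).
apply: le_trans; rewrite !mulr_sumr -big_split/=; apply: ler_sum => k _.
rewrite -[(_ + g) _]/((a +i* b)%C * f k + g k).
case: (f k) (g k) => [c d] [p q]; rewrite /rdot/=.
set X := a * c - b * d; set Y := a * d + b * c.
have -> : 2 * (a ^+ 2 + b ^+ 2) * (c * c + d * d) + 2 * (p * p + q * q) =
  ((X + p) * (X + p) + (Y + q) * (Y + q)) + ((X - p) * (X - p) + (Y - q) * (Y - q)).
  by rewrite /X /Y; ring.
by rewrite lerDl addr_ge0// -expr2 sqr_ge0.
Qed.

HB.instance Definition _ := GRing.isSubmodClosed.Build C (nat -> C) ell2_pred
  ell2_submod_closed.

Record ell2 : Type := Ell2 { ell2_val :> nat -> C; _ : ell2_val \in ell2_pred }.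

HB.instance Definition _ := [isSub for ell2_val].
HB.instance Definition _ := [Choice of ell2 by <:].
HB.instance Definition _ := [SubChoice_isSubLmodule of ell2 by <:].

Implicit Types u v w : ell2.

Lemma ell2P u : square_summable u.
Proof. by case: u => u /= /asboolP. Qed.

Lemma ell2_ext u v : u =1 v -> u = v.
Proof. by move=> uv; apply/val_inj/funext. Qed.

Lemma ell2B u v k : (u - v) k = u k - v k. Proof. by []. Qed.
Definition rip u v : R := limn (series (fun k => rdot (u k) (v k))).

Lemma rdot_le z1 z2 : `|rdot z1 z2| <= rdot z1 z1 + rdot z2 z2.
Proof.
rewrite /rdot; case: z1 z2 => [a b] [c d]/=.
have := (sqr_ge0 (a + c), sqr_ge0 (b + d), sqr_ge0 (a - c), sqr_ge0 (b - d)).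
rewrite !expr2 => -[[[ac bd] ac'] bd'].
by rewrite ler_norml; apply/andP; split; nra.
Qed.

Lemma is_cvg_rip_self u : cvgn (series (fun k => rdot (u k) (u k))).
Proof.
apply: nondecreasing_is_cvgn.
  by apply: nondecreasing_series => n _ _; exact: rdot_ge0.
have [B uB] := ell2P u; exists B => _ [n _ <-]; rewrite /series/= big_mkord.
exact: uB.
Qed.

Lemma is_cvg_rip u v : cvgn (series (fun k => rdot (u k) (v k))).
Proof.
apply: normed_cvg; apply: (@series_le_cvg _ _
  (fun k => rdot (u k) (u k) + rdot (v k) (v k))).
- by move=> n; exact: normr_ge0.
- by move=> n; rewrite addr_ge0 ?rdot_ge0.
- by move=> n; exact: rdot_le.
- by have := is_cvg_seriesD (@is_cvg_rip_self u) (@is_cvg_rip_self v).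
Qed.

Lemma ripP u v : series (fun k => rdot (u k) (v k)) @ \oo --> rip u v.
Proof. exact: is_cvg_rip. Qed.

Lemma ripC u v : rip u v = rip v u.
Proof.
rewrite /rip; congr (limn (series _)); apply/funext => k.
by rewrite /rdot; ring.
Qed.

Lemma ripDl u v w : rip (u + v) w = rip u w + rip v w.
Proof.
rewrite /rip -lim_seriesD; [|exact: is_cvg_rip..].
congr (limn (series _)); apply/funext => k /=.
rewrite -[LHS]/(rdot (u k + v k) (w k)) -[RHS]/(rdot _ _ + rdot _ _) /rdot.
by case: (u k) (v k) (w k) => [p q] [r s] [a b]/=; ring.
Qed.

Lemma ripZl (a : R) u w : rip (a%:C%C *: u) w = a * rip u w.
Proof.
rewrite /rip -[RHS](lim_seriesZ a); last exact: is_cvg_rip.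
congr (limn (series _)); apply/funext => k.
rewrite -[LHS]/(rdot (a%:C%C * u k) (w k)) -[RHS]/(a * rdot (u k) (w k)) /rdot.
by case: (u k) (w k) => [p q] [r s]/=; ring.
Qed.

Lemma rip_i u v : rip ('i%C *: u) ('i%C *: v) = rip u v.
Proof.
rewrite /rip; congr (limn (series _)); apply/funext => k.
rewrite -[LHS]/(rdot ('i%C * u k) ('i%C * v k)) /rdot.
by case: (u k) (v k) => [p q] [r s]/=; ring.
Qed.

Lemma rip_partial u n : \sum_(k < n) rdot (u k) (u k) <= rip u u.
Proof.
have := @nondecreasing_cvgn_le R (series (fun k => rdot (u k) (u k))).
rewrite -/(rip u u) => /(_ _ (@is_cvg_rip_self u) n).
rewrite /series/= big_mkord; apply.
by apply: nondecreasing_series => k _ _; exact: rdot_ge0.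
Qed.

Lemma rip_le u B : (forall n, \sum_(k < n) rdot (u k) (u k) <= B) -> rip u u <= B.
Proof.
move=> uB; apply: limr_le; first exact: is_cvg_rip.
by near=> n; rewrite /series/= big_mkord.
Unshelve. all: by end_near. Qed.

Lemma rip_ge0 u : 0 <= rip u u.
Proof. by have := rip_partial u 0; rewrite big_ord0. Qed.

Lemma rip_coord u k : rdot (u k) (u k) <= rip u u.
Proof.
apply: le_trans (rip_partial u k.+1); rewrite big_ord_recr/= lerDr.
by apply: sumr_ge0 => i _; exact: rdot_ge0.
Qed.

Lemma rdot_eq0 z : rdot z z <= 0 -> z = 0.
Proof.
case: z => a b; rewrite /rdot/= => ab.
have : a * a + b * b = 0 by apply/eqP; rewrite eq_le ab addr_ge0// -expr2 sqr_ge0.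
move/eqP; rewrite paddr_eq0 -?expr2 ?sqr_ge0// !sqrf_eq0.
by move=> /andP[/eqP -> /eqP ->].
Qed.

Lemma rip_eq0 u : rip u u <= 0 -> u = 0.
Proof.
move=> u0; apply: ell2_ext => k; apply: rdot_eq0.
exact: le_trans (rip_coord u k) u0.
Qed.

Lemma ripDr u v w : rip w (u + v) = rip w u + rip w v.
Proof. by rewrite ripC ripDl !(ripC w). Qed.

Lemma ripZr (a : R) u w : rip w (a%:C%C *: u) = a * rip w u.
Proof. by rewrite ripC ripZl (ripC w). Qed.

Lemma rip_cauchy_schwarz u v : rip u v ^+ 2 <= rip u u * rip v v.
Proof.
have [v0|v0] := leP (rip v v) 0.
  rewrite (rip_eq0 v0) -(scale0r (0 : ell2)) -[0 : C]/((0 : R)%:C%C).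
  by rewrite !ripZr !mul0r mulr0 expr0n.
have := rip_ge0 ((rip v v)%:C%C *: u + (- rip u v)%:C%C *: v).
rewrite !ripDl !ripDr !ripZl !ripZr (ripC v u).
move: v0; move: (rip u v) (rip u u) (rip v v) => b a c c0.
have -> : c * (c * a) + c * (- b * b) + (- b * (c * b) + - b * (- b * c)) =
  c * (a * c - b ^+ 2) by ring.
by rewrite pmulr_rge0// subr_ge0.
Qed.

Definition ell2_norm u : C := (Num.sqrt (rip u u))%:C%C.

Lemma ell2_norm_triangle u v :
  Num.sqrt (rip (u + v) (u + v)) <= Num.sqrt (rip u u) + Num.sqrt (rip v v).
Proof.
rewrite -(ler_sqr (x := Num.sqrt _)) ?nnegrE ?addr_ge0 ?sqrtr_ge0//.
rewrite sqrrD !sqr_sqrtr ?rip_ge0// ripDl !ripDr (ripC v u).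
have : rip u v <= Num.sqrt (rip u u) * Num.sqrt (rip v v).
  rewrite -sqrtrM ?rip_ge0//; apply: le_trans (ler_norm _) _.
  by rewrite -sqrtr_sqr ler_wsqrtr// rip_cauchy_schwarz.
rewrite mulr2n; lra.
Qed.

Lemma ell2_norm_Dle u v : ell2_norm (u + v) <= ell2_norm u + ell2_norm v.
Proof. by rewrite /ell2_norm -rmorphD lecR ell2_norm_triangle. Qed.

Lemma rip_iself u : rip ('i%C *: u) u = 0.
Proof.
have : rip ('i%C *: u) u = - rip ('i%C *: u) u.
  rewrite -{1}rip_i scalerA -expr2 sqr_i.
  have -> : -1 = (- 1 : R)%:C%C :> C by simpc.
  by rewrite ripZl mulN1r ripC.
lra.
Qed.

Lemma ripZ (a : C) u : rip (a *: u) (a *: u) = (Re a ^+ 2 + Im a ^+ 2) * rip u u.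
Proof.
case: a => a b.
have -> : (a +i* b)%C = a%:C%C + b%:C%C * 'i%C :> C by simpc.
rewrite scalerDl -scalerA ripDl !ripDr !ripZl !ripZr rip_i (ripC u) rip_iself.
simpc => /=; ring.
Qed.

Lemma ell2_normZ (a : C) u : ell2_norm (a *: u) = `|a| * ell2_norm u.
Proof.
rewrite /ell2_norm ripZ sqrtrM; last by rewrite addr_ge0 ?sqr_ge0.
by rewrite rmorphM normc_def.
Qed.

Lemma ell2_norm_eq0 u : ell2_norm u = 0 -> u = 0.
Proof.
move=> /eqP; rewrite -[0]/((0 : R)%:C%C) (inj_eq (@complexI R)) sqrtr_eq0.
exact: rip_eq0.
Qed.

HB.instance Definition _ := Lmodule_isNormed.Build C ell2
  ell2_norm_Dle ell2_normZ ell2_norm_eq0.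


Lemma ell2_normE u : `|u| = (Num.sqrt (rip u u))%:C%C :> C.
Proof. by []. Qed.

(** The imaginary part of the inner product of u and v is the real part of that
    of u and i v. *)
Definition ell2_ip u v : C := (rip u v +i* rip u ('i%C *: v))%C.

Lemma ell2_ip_linearl v : GRing.linear_for *%R (ell2_ip^~ v).
Proof.
have iu u : rip ('i%C *: u) v = - rip u ('i%C *: v).
  rewrite -(rip_i u) scalerA -expr2 sqr_i.
  have -> : -1 = (- 1 : R)%:C%C :> C by simpc.
  by rewrite ripZr mulN1r opprK.
move=> [a b] u w; rewrite /ell2_ip !ripDl.
have -> : (a +i* b)%C = a%:C%C + b%:C%C * 'i%C :> C by simpc.
rewrite scalerDl -scalerA !ripDl !ripZl rip_i iu.
by simpc => /=; congr Complex; ring.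
Qed.

Lemma ell2_ip_herm u v : ell2_ip u v = (-1) ^+ false * Num.conj (ell2_ip v u).
Proof.
rewrite expr0 mul1r /ell2_ip.
have -> : rip v ('i%C *: u) = - rip u ('i%C *: v).
  rewrite ripC -(rip_i u) scalerA -expr2 sqr_i.
  have -> : -1 = (- 1 : R)%:C%C :> C by simpc.
  by rewrite ripZr mulN1r opprK.
by rewrite /Num.conj/= opprK ripC.
Qed.

Lemma ell2_ip_linearr u : GRing.linear_for (Num.conj \; *%R) (ell2_ip u).
Proof.
move=> a v w; rewrite (ell2_ip_herm u) ell2_ip_linearl expr0 mul1r rmorphD rmorphM/=.
by congr (_ * _ + _); rewrite [RHS]ell2_ip_herm expr0 mul1r.
Qed.

HB.instance Definition _ := bilinear_isBilinear.Build C ell2 ell2 C *%R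
  (Num.conj \; *%R) ell2_ip (ell2_ip_linearl, ell2_ip_linearr).
HB.instance Definition _ := isHermitianSesquilinear.Build C ell2 false Num.conj
  ell2_ip ell2_ip_herm.

Lemma ell2_ip_self u : ell2_ip u u = (rip u u)%:C%C.
Proof. by rewrite /ell2_ip ripC rip_iself. Qed.

Lemma ell2_ip_gt0 u : u != 0 -> 0 < ell2_ip u u.
Proof.
move=> u0; rewrite ell2_ip_self -[0]/((0 : R)%:C%C) ltcR lt_neqAle rip_ge0 andbT.
by apply: contra u0 => /eqP u0; apply/eqP/rip_eq0; rewrite -u0.
Qed.

HB.instance Definition _ := isDotProduct.Build C ell2 ell2_ip ell2_ip_gt0.

Lemma ell2_ball u v (e : R) : 0 < e ->
  ball u e%:C%C v <-> rip (u - v) (u - v) < e ^+ 2.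
Proof.
move=> e0; rewrite -ball_normE /= ell2_normE ltcR.
by rewrite -{1}(ger0_norm (ltW e0)) -sqrtr_sqr ltr_sqrt ?exprn_gt0.
Qed.

Lemma ell2_pred_lim u (f : nat -> C) (B : R) :
  (forall n, \sum_(k < n) rdot (u k - f k) (u k - f k) <= B) -> f \in ell2_pred.
Proof.
move=> uf.
have gP : (u \- f : nat -> C) \in ell2_pred.
  by apply/asboolP; exists B => n; exact: uf.
have -> : f = ell2_val u - ell2_val (Ell2 gP).
  by apply/funext => k; rewrite -[RHS]/(u k - (u k - f k)) subKr.
by apply: rpredB; [case: u {uf gP} | case: (Ell2 gP)].
Qed.

Lemma cvg_coord (F : set_system ell2) (p : C -> R) :
  (forall z1 z2, p z1 - p z2 = p (z1 - z2)) -> (forall z, p z ^+ 2 <= rdot z z) ->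
  ProperFilter F -> cauchy F -> forall k, cvg ((fun u => p (u k)) @ F).
Proof.
move=> pB ple FF /cauchyP Fc k; apply/cauchy_cvgP/cauchy_exP => e e0.
have [|u Fu] := Fc e%:C%C; first by rewrite -[0]/((0 : R)%:C%C) ltcR.
exists (p (u k)).
change (F ((fun v : ell2 => p (v k)) @^-1` ball (p (u k)) e)).
apply: filterS Fu => v /(ell2_ball _ _ e0) uv.
rewrite -ball_normE /= pB -(ltr_sqr (x := `|_|)) ?nnegrE// ?ltW//.
rewrite real_normK ?num_real//; apply: le_lt_trans uv.
apply: le_trans (ple _) _; exact: (rip_coord (u - v)).
Qed.

Lemma posc_real (e : C) : 0 < e -> exists2 r : R, 0 < r & e = r%:C%C.
Proof.
move=> e0; have eE : e = (Re e)%:C%C.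
  by have := ger0_Im (ltW e0); case: e {e0} => a b /= ->.
by exists (Re e) => //; move: e0; rewrite eE -[0]/((0 : R)%:C%C) ltcR.
Qed.

(** A Cauchy filter converges in each coordinate, and bounds for partial sums of
    squares pass to the limit. *)
Lemma ell2_complete (F : set_system ell2) : ProperFilter F -> cauchy F -> cvg F.
Proof.
move=> FF Fc.
have cre := @cvg_coord F Re (fun z1 z2 => esym (raddfB _ _ _)) _ FF Fc.
have cim := @cvg_coord F Im (fun z1 z2 => esym (raddfB _ _ _)) _ FF Fc.
have {}cre : forall k, cvg ((fun u : ell2 => Re (u k)) @ F).
  by apply: cre => z; rewrite /rdot -!expr2 lerDl sqr_ge0.
have {}cim : forall k, cvg ((fun u : ell2 => Im (u k)) @ F).
  by apply: cim => z; rewrite /rdot -!expr2 lerDr sqr_ge0.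
pose f k : C := (lim ((fun u : ell2 => Re (u k)) @ F) +i*
                 lim ((fun u : ell2 => Im (u k)) @ F))%C.
have near_f (u : ell2) (e : R) : 0 < e -> F (ball u e%:C%C) ->
    forall n, \sum_(k < n) rdot (u k - f k) (u k - f k) <= e ^+ 2.
  move=> e0 Fu n.
  have cv : (fun v : ell2 => \sum_(k < n) rdot (u k - v k) (u k - v k)) @ F -->
      \sum_(k < n) rdot (u k - f k) (u k - f k).
    apply: cvg_big => [|k _]; first exact: add_continuous.
    have -> : (fun v : ell2 => rdot (u k - v k) (u k - v k)) =
        (fun v : ell2 => (Re (u k) - Re (v k)) * (Re (u k) - Re (v k)) +
                         (Im (u k) - Im (v k)) * (Im (u k) - Im (v k))).
      by apply/funext => v; rewrite /rdot !raddfB.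
    rewrite /rdot !raddfB /=.
    have cR : (fun v : ell2 => Re (u k) - Re (v k)) @ F --> Re (u k) - Re (f k).
      by apply: cvgB; [exact: cvg_cst|exact: cre].
    have cI : (fun v : ell2 => Im (u k) - Im (v k)) @ F --> Im (u k) - Im (f k).
      by apply: cvgB; [exact: cvg_cst|exact: cim].
    by apply: cvgD; apply: cvgM.
  rewrite -(cvg_lim _ cv)//; apply: limr_le; first by apply/cvg_ex; eexists; exact: cv.
  apply: filterS Fu => v /(ell2_ball _ _ e0)/ltW; apply: le_trans.
  exact: (rip_partial (u - v)).
have fP : f \in ell2_pred.
  have /cauchyP/(_ 1) [//|u Fu] := Fc.
  by apply: (@ell2_pred_lim u f (1 ^+ 2)); exact: (near_f u 1 ltr01 Fu).
apply/cvg_ex; exists (Ell2 fP); apply/cvg_ballP => e e0.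
have [r r0 eE] := posc_real e0.
have /cauchyP/(_ (r / 2)%:C%C)[|u Fu] := Fc.
  by rewrite -[0]/((0 : R)%:C%C) ltcR divr_gt0.
have e20 : 0 < r / 2 by rewrite divr_gt0.
have uf : rip (u - Ell2 fP) (u - Ell2 fP) <= (r / 2) ^+ 2.
  by apply: rip_le => n; exact: near_f.
have fu : `|Ell2 fP - u| <= (r / 2)%:C%C.
  by rewrite distrC ell2_normE lecR -[leRHS](ger0_norm (ltW e20)) -sqrtr_sqr ler_wsqrtr.
apply: filterS Fu => v; rewrite -!ball_normE/= => uv.
apply: le_lt_trans (ler_distD u _ _) _.
by rewrite eE [r]splitr rmorphD ler_ltD.
Qed.

HB.instance Definition _ := Uniform_isComplete.Build ell2 ell2_complete.

Definition ell2_dot : {dot ell2 for Num.conj} := ell2_ip.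

Lemma ell2_norm_of_dot : norm_of_dot ell2_dot.
Proof.
move=> u; rewrite -[RHS]/(ell2_ip u u) ell2_ip_self ell2_normE -rmorphXn/=.
by rewrite sqr_sqrtr ?rip_ge0.
Qed.


Lemma lim_series_finite (t : nat -> R) N : (forall k, (N <= k)%N -> t k = 0) ->
  limn (series t) = \sum_(k < N) t k.
Proof.
move=> t0; apply: cvg_lim => //; apply: cvg_near_cst; exists N => // n /= Nn.
rewrite /series/= big_mkord -(subnKC Nn) big_split_ord/=.
by rewrite [X in _ + X]big1 ?addr0// => k _; apply: t0; exact: leq_addr.
Qed.

Lemma finite_support_ell2 (f : nat -> C) N : (forall k, (N <= k)%N -> f k = 0) ->
  f \in ell2_pred.
Proof.
move=> f0; apply/asboolP; exists (\sum_(k < N) rdot (f k) (f k)) => n.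
rewrite -!(big_mkord predT (fun k => rdot (f k) (f k))).
have [nN|/ltnW Nn] := leqP n N.
  rewrite (big_cat_nat (leq0n n) nN)//= lerDl sumr_ge0// => i _; exact: rdot_ge0.
rewrite (big_cat_nat (leq0n N) Nn)//= gerDl big_nat_cond big1// => i /andP[/andP[Ni _] _].
by rewrite f0// /rdot !mul0r addr0.
Qed.

Lemma poly_ell2_subproof (p : {poly R}) : (fun k => (p`_k)%:C%C) \in ell2_pred.
Proof. by apply: (@finite_support_ell2 _ (size p)) => k kp; rewrite nth_default. Qed.

Definition poly_ell2 (p : {poly R}) : ell2 := Ell2 (poly_ell2_subproof p).

Lemma poly_ell2_ip (p q : {poly R}) :
  ell2_ip (poly_ell2 p) (poly_ell2 q) = (\sum_(k < size p) p`_k * q`_k)%:C%C.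
Proof.
rewrite /ell2_ip /rip; congr Complex; last first.
  rewrite (@lim_series_finite _ 0) ?big_ord0// => k _.
  by rewrite -[LHS]/(rdot (p`_k)%:C%C ('i%C * (q`_k)%:C%C)) /rdot/=; ring.
rewrite (@lim_series_finite _ (size p)); last first.
  by move=> k kp; rewrite /rdot/= nth_default// !mul0r addr0.
by apply: eq_bigr => k _; rewrite /rdot/= mul0r addr0.
Qed.

Definition ell2_basis (j : nat) : ell2 := poly_ell2 'X^j.

Lemma ell2_basis_ip (h : ell2) j : ell2_ip h (ell2_basis j) = h j.
Proof.
have hj : h j = (Re (h j) +i* Im (h j))%C by case: (h j).
rewrite [RHS]hj /ell2_ip /rip; congr Complex.
  rewrite (@lim_series_finite _ j.+1); last first.
    move=> k kj; rewrite /rdot/= coefXn gtn_eqF//= !mulr0; exact: addr0.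
  rewrite big_ord_recr/= big1 ?add0r; last first.
    move=> k _; rewrite /rdot/= coefXn ltn_eqF//= !mulr0; exact: addr0.
  by rewrite /rdot/= coefXn eqxx/= mulr1 mulr0 addr0.
rewrite (@lim_series_finite _ j.+1); last first.
  move=> k kj; rewrite -[LHS]/(rdot (h k) ('i%C * (('X^j : {poly R})`_k)%:C%C)) coefXn gtn_eqF//.
  by rewrite /rdot mulr0/= !mulr0 addr0.
rewrite big_ord_recr/= big1 ?add0r; last first.
  move=> k _; rewrite -[LHS]/(rdot (h k) ('i%C * (('X^j : {poly R})`_k)%:C%C)) coefXn ltn_eqF//.
  by rewrite /rdot mulr0/= !mulr0 addr0.
rewrite -[LHS]/(rdot (h j) ('i%C * (('X^j : {poly R})`_j)%:C%C)) coefXn eqxx /rdot/=; ring.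
Qed.

Lemma ell2_basis_complete : complete_orthonormal_seq ell2_dot ell2_basis.
Proof.
split=> [i j|h h0]; last first.
  by apply: ell2_ext => j; rewrite -ell2_basis_ip; exact: h0.
rewrite -[LHS]/(ell2_ip _ _) ell2_basis_ip/= coefXn eq_sym.
by case: (i == j).
Qed.

Lemma ell2_tail u (e : R) : 0 < e ->
  exists N, forall n, \sum_(N <= k < n) rdot (u k) (u k) < e.
Proof.
move=> e0; have /cvgrPdist_lt/(_ e e0)[N _ /(_ N (leqnn N))] := @ripP u u.
rewrite {1}/series/= big_mkord => uN; exists N => n.
have [Nn|nN] := leqP N n; last by rewrite big_geq// ltnW.
apply: le_lt_trans uN; apply: le_trans (ler_norm _).
rewrite lerBrDl; apply: le_trans (rip_partial u n).
by rewrite -!(big_mkord predT (fun k => rdot (u k) (u k))) [leRHS](big_cat_nat (leq0n N) Nn).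
Qed.

Definition gaussian_rational (q : rat * rat) : C := (ratr q.1 +i* ratr q.2)%C.

Lemma gaussian_rational_dense z (e : R) : 0 < e ->
  exists q, rdot (z - gaussian_rational q) (z - gaussian_rational q) < e.
Proof.
move=> e0; have s0 : 0 < Num.sqrt (e / 2) by rewrite sqrtr_gt0 divr_gt0.
have approx (a : R) : exists q : rat, (a - ratr q) ^+ 2 < e / 2.
  have [|q] := @rat_in_itvoo R (a - Num.sqrt (e / 2)) (a + Num.sqrt (e / 2)).
    by rewrite ltrD2l gtrN.
  rewrite in_itv/= => /andP[q1 q2]; exists q.
  rewrite -[ltRHS]sqr_sqrtr ?divr_ge0 ?ltW//.
  rewrite -(ger0_norm (ltW s0)) -[ltRHS]real_normK ?num_real// -[ltLHS]real_normK ?num_real//.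
  rewrite ltr_sqr ?nnegrE// normr_id (ger0_norm (ltW s0)) ltr_norml.
  by apply/andP; split; lra.
have [q1 hq1] := approx (Re z); have [q2 hq2] := approx (Im z).
exists (q1, q2); move: hq1 hq2; case: z => a b /= hq1 hq2.
by rewrite /rdot/= -!expr2 [ltRHS]splitr ltrD.
Qed.

Lemma gaussian_rational0 : gaussian_rational (0, 0) = 0.
Proof. by rewrite /gaussian_rational/= !raddf0. Qed.

Lemma gaussian_seq_subproof (s : seq (rat * rat)) :
  (fun k => gaussian_rational (nth (0, 0) s k)) \in ell2_pred.
Proof.
apply: (@finite_support_ell2 _ (size s)) => k ks.
by rewrite nth_default// gaussian_rational0.
Qed.

(** Finite sequences of Gaussian rationals are dense. *)
Lemma ell2_separable : separable (ell2 : completeNormedModType C).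
Proof.
exists (range (fun s => Ell2 (gaussian_seq_subproof s))).
  apply: (@card_le_trans _ _ _ [set: seq (rat * rat)]); last exact: countableP.
  exact: card_image_le.
move=> O [u Ou] oO.
have /nbhs_ballP[e /= /posc_real[r r0 ->] eO] : nbhs u O by exact: open_nbhs_nbhs.
have r2 : 0 < r ^+ 2 / 2 by rewrite divr_gt0 ?exprn_gt0.
have [N tailN] := ell2_tail u r2.
have d0 : 0 < r ^+ 2 / 4 / N.+1%:R by rewrite !divr_gt0 ?exprn_gt0.
have [q hq] := choice (fun k => gaussian_rational_dense (u k) d0).
exists (Ell2 (gaussian_seq_subproof (mkseq q N))); split; last by exists (mkseq q N).
apply/eO/ell2_ball => //; apply: (@le_lt_trans _ _ (r ^+ 2 / 4 + r ^+ 2 / 2)); last by nra.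
apply: rip_le => n; rewrite -(big_mkord predT (fun k => rdot ((u - _) k) ((u - _) k))).
apply: (@le_trans _ _ (\sum_(0 <= k < N) r ^+ 2 / 4 / N.+1%:R +
    \sum_(N <= k < n) rdot (u k) (u k))); last first.
  rewrite lerD ?(ltW (tailN _))// sumr_const_nat subn0 -[leRHS]mulr1 -mulrnAr.
  apply: ler_wpM2l; first by rewrite divr_ge0 ?exprn_ge0 ?ltW.
  by rewrite -[leLHS]mulr_natl ler_pdivrMr// mul1r ler_nat.
have le1 k : (k < N)%N -> rdot ((u - Ell2 (gaussian_seq_subproof (mkseq q N))) k)
    ((u - Ell2 (gaussian_seq_subproof (mkseq q N))) k) <= r ^+ 2 / 4 / N.+1%:R.
  by move=> kN; rewrite ell2B/= nth_mkseq// ltW.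
have le2 k : (N <= k)%N -> rdot ((u - Ell2 (gaussian_seq_subproof (mkseq q N))) k)
    ((u - Ell2 (gaussian_seq_subproof (mkseq q N))) k) = rdot (u k) (u k).
  by move=> Nk; rewrite ell2B/= nth_default ?size_mkseq// gaussian_rational0 subr0.
have [Nn|/ltnW nN] := leqP N n.
  rewrite (big_cat_nat (leq0n N) Nn)/=; apply: lerD.
    by apply: ler_sum_nat => k /andP[_ kN]; exact: le1.
  by apply: ler_sum_nat => k /andP[Nk _]; rewrite le2.
rewrite (big_geq nN) addr0 (big_cat_nat (leq0n n) nN)/= -[leLHS]addr0.
apply: lerD; last by apply: sumr_ge0 => k _; exact: ltW.
by apply: ler_sum_nat => k /andP[_ kn]; apply: le1; exact: leq_trans kn nN.
Qed.

End EllTwo.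

(** * Unistochastic matrices *)

Section Final.
Variable R : realType.
Implicit Types (w : nat -> nat -> R) (x y z : nat -> R).

Lemma nneseries_le (f : nat -> R) B : (forall n, 0 <= f n) ->
  (forall n, \sum_(0 <= k < n) f k <= B) <-> (\sum_(0 <= k <oo) (f k)%:E <= B%:E)%E.
Proof.
move=> f0; split=> fB; last first.
  move=> n; rewrite -lee_fin -sumEFin; apply: le_trans fB.
  by apply: (@nneseries_lim_ge _ _ xpredT 0%N n) => k _ _; rewrite lee_fin.
apply: lime_le; first by apply: is_cvg_nneseries => k _ _; rewrite lee_fin.
by near=> n; rewrite sumEFin lee_fin.
Unshelve. all: by end_near. Qed.

Lemma row_stochastic_acts w x : row_stochastic w -> mx_dom w x -> acts w x (mx_act w x).
Proof.
move=> [w0 w1 wc] dom; split=> [//|i|j G Gu|i].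
- have cv : cvgn (fun n => \sum_(0 <= k < n) (w i k)%:E)%E.
    by apply: is_cvg_nneseries => k _ _; rewrite lee_fin.
  have : ((fun n => \sum_(0 <= k < n) (w i k)%:E) @ \oo --> 1%:E)%E by rewrite -(w1 i).
  move/fine_cvg; rewrite (_ : fine \o _ = series (w i))//.
  by apply/funext => n /=; rewrite sumEFin.
- have wj := (nneseries_le 1 (fun n => w0 n j)).2 (wc j).
  pose N := (\max_(n <- G) n).+1; apply: le_trans (wj N).
  rewrite [leRHS](bigID (mem G))/= -[leLHS]addr0 lerD//; last by apply: sumr_ge0.
  rewrite -[leRHS]big_filter le_eqVlt; apply/orP; left; apply/eqP/perm_big/uniq_perm => //.
    by rewrite filter_uniq// iota_uniq.
  move=> n; rewrite mem_filter/=; case nG: (n \in G) => //=.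
  by rewrite mem_index_iota/= ltnS; apply/esym; exact: (@leq_bigmax_seq _ G xpredT id).
- apply: normed_cvg; apply: nondecreasing_is_cvgn.
    by apply: nondecreasing_series => k _ _; exact: normr_ge0.
  have /fineK finB : (\sum_(0 <= j <oo) `|w i j * x j|%:E)%E \is a fin_num.
    rewrite ge0_fin_numE; first exact: dom.
    by apply: nneseries_ge0 => k _ _; rewrite lee_fin.
  have := (nneseries_le (fine (\sum_(0 <= j <oo) `|w i j * x j|%:E)%E)
    (fun j => normr_ge0 (w i j * x j))).2.
  by rewrite finB lexx => /(_ isT) B; exists (fine (\sum_(0 <= j <oo) `|w i j * x j|%:E)%E)
    => _ [n _ <-]; exact: B.
Qed.

(** Bessel's inequality for the j-th basis vector, from the norms of its
    successive remainders. *)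
Lemma bessel_columns (u : nat -> {poly R}) N j :
  (forall i k, wform (fun=> 1) (u i) (u k) = (i == k)%:R) ->
  \sum_(0 <= i < N) (u i)`_j ^+ 2 <= 1.
Proof.
move=> uo; pose q M := 'X^j - \sum_(0 <= i < M) (u i)`_j *: u i.
have Xu (p : {poly R}) : wform (fun=> 1) 'X^j p = p`_j.
  rewrite /wform size_polyXn big_ord_recr/= big1 ?add0r.
    by rewrite coefXn eqxx !mul1r.
  by move=> k _; rewrite coefXn ltn_eqF// mul0r mulr0.
have self_ge0 (p : {poly R}) : 0 <= wform (fun=> 1) p p.
  by apply: sumr_ge0 => k _; rewrite mul1r -expr2 sqr_ge0.
have qS M : q M.+1 = q M + - (u M)`_j *: u M.
  by rewrite /q big_nat_recr//= opprD addrA scaleNr.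
have q0 : q 0%N = 'X^j by rewrite /q big_geq// subr0.
clearbody q.
have qu M i : (M <= i)%N -> wform (fun=> 1) (q M) (u i) = (u i)`_j.
  elim: M => [|M IH] Mi; first by rewrite q0 Xu.
  by rewrite qS wformDl wformZl uo (ltn_eqF Mi) mulr0 addr0 IH// ltnW.
have qq M : wform (fun=> 1) (q M) (q M) = 1 - \sum_(0 <= i < M) (u i)`_j ^+ 2.
  elim: M => [|M IH]; first by rewrite q0 big_geq// subr0 Xu coefXn eqxx.
  rewrite big_nat_recr//= opprD addrA -IH qS.
  rewrite wformDl !wformDr !wformZl !wformZr qu// (wformC _ (u M)) qu// uo eqxx mulr1.
  ring.
by have := self_ge0 (q N); rewrite qq subr_ge0.
Qed.

(** The matrix of squared coordinates has finite rows, so all the series that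
    act on [x] are finite sums. *)
Lemma realizable_US_set x y : realizable x y setT setT -> US_set x y.
Proof.
move=> [u [_ uo ux]].
have {}uo i k : wform (fun=> 1) (u i) (u k) = (i == k)%:R by exact: uo.
have {}ux i : wform x (u i) (u i) = y i by exact: ux.
pose w i j := (u i)`_j ^+ 2.
have w0 i j : 0 <= w i j by exact: sqr_ge0.
have wz i k : (size (u i) <= k)%N -> w i k = 0.
  by move=> ik; rewrite /w nth_default// expr0n.
have row_finite i (f : nat -> R) : (forall k, (size (u i) <= k)%N -> f k = 0) ->
    (\sum_(0 <= j <oo) (f j)%:E = (\sum_(j < size (u i)) f j)%:E)%E.
  move=> f0; apply: cvg_lim => //; apply: cvg_near_cst.
  exists (size (u i)) => // n /= ni; rewrite sumEFin; congr EFin.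
  rewrite big_mkord -(subnKC ni) big_split_ord/=.
  by rewrite [X in _ + X]big1 ?addr0// => k _; apply: f0; exact: leq_addr.
exists w; split.
- split; last first.
    exists (ell2 R), (ell2_dot R), (@ell2_basis R), (fun i => poly_ell2 (u i)); split.
    + exact: ell2_norm_of_dot.
    + exact: ell2_separable.
    + exact: ell2_basis_complete.
    + move=> i k; rewrite -[LHS]/(ell2_ip _ _) poly_ell2_ip.
      have := uo i k; rewrite /wform; under eq_bigr do rewrite mul1r.
      by move=> ->; case: (i == k).
    + move=> i j; rewrite -[ell2_dot R _ _]/(ell2_ip _ _) ell2_basis_ip/= sqr_normc.
      by rewrite conjc_real -rmorphM -expr2.
  split=> [//|i|j].
    rewrite (row_finite i); last by move=> k /wz.
    transitivity (wform (fun=> 1) (u i) (u i))%:E; last by rewrite uo eqxx.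
    by congr EFin; apply: eq_bigr => k _; rewrite mul1r -expr2.
  by apply/nneseries_le => // N; exact: bessel_columns.
- move=> i; rewrite (row_finite i (fun j => `|w i j * x j|)) ?ltry// => k ki.
  by rewrite wz// mul0r normr0.
- apply/funext => i; rewrite /mx_act (@lim_series_finite _ _ (size (u i))); last first.
    by move=> k ki; rewrite wz// mul0r.
  by rewrite -ux; apply: eq_bigr => k _; rewrite /w expr2 mulrC.
Qed.

Lemma US_set_sub x : US_set x `<=` S_set x.
Proof. by move=> y [w [[ws _] dom yE]]; exists w. Qed.

Lemma S_set_acts x y : S_set x y -> exists w, acts w x y.
Proof. by move=> [w [ws dom ->]]; exists w; exact: row_stochastic_acts. Qed.

Lemma S_set_sub_Q x : S_set x `<=` Q_set x.
Proof.
move=> y /S_set_acts[w wxy]; apply/Q_set_majorized.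
by split=> s; [apply: (acts_dominated wxy)|apply: (acts_dominated (actsN wxy))].
Qed.

End Final.


Theorem theorem3p10 (R : realType) (x xhat : nat -> R) (hxhat : is_hat x xhat) :
  [/\ US_set x = S_set x, S_set x `<=` Q_set x, Q_set x = Q_set xhat
    & Q_set xhat = US_set xhat].
Proof.
have xz := is_hat_hatted hxhat; split.
- apply/seteqP; split; first exact: US_set_sub.
  by move=> y /S_set_acts[w wxy]; apply/realizable_US_set/(acts_realizable wxy).
- exact: S_set_sub_Q.
- apply/seteqP; split=> y /Q_set_majorized[up low]; apply/Q_set_majorized; split.
  + exact/(limit_copies_majorized y xz).
  + exact/(limit_copies_majorized _ (limit_copies_addedN xz)).
  + exact/(limit_copies_majorized y xz).
  + exact/(limit_copies_majorized _ (limit_copies_addedN xz)).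
- apply/seteqP; split=> [y /Q_set_majorized[up low]|y /US_set_sub/S_set_sub_Q//].
  exact/realizable_US_set/(limit_copies_realizable xz).
Qed.
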